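(* Let $\alpha\in(0,1)$, $T>0$, and let $\Omega\subset\mathbb{R}^d$, $d\in\{1,2,3\}$, be a bounded Lipschitz domain. Let $\mathcal{L}=\mathcal{L}(t)$ be the operator $$\mathcal{L}u:=-\sum_{i,j=1}^d\partial_{x_i}\bigl(a_{ij}(x,t)\,\partial_{x_j}u\bigr)+\sum_{i=1}^d b_i(x,t)\,\partial_{x_i}u ,$$ where the matrix $\{a_{ij}(x,t)\}_{i,j=1}^d$ is symmetric positive definite for every $(x,t)\in\Omega\times(0,T]$ and, for each $t\in(0,T]$, $a_{ij}(\cdot,t)\in C^1(\Omega)$, $b_i(\cdot,t)\in C(\Omega)$ and $c(\cdot,t)\in C(\Omega)$. Let $c(x,t)\ge-\lambda$ for all $(x,t)\in\Omega\times(0,T]$ with some constant $\lambda\ge0$. Suppose that $u(x,0)\le0$ for all $x\in\Omega$ and $u(x,t)\le0$ for all $(x,t)\in\partial\Omega\times[0,T]$, and also $u\in C(\bar\Omega\times[0,T])$, $u(\cdot,t)\in C^2(\Omega)$ for any $t>0$ (i.e. any $t\in(0,T]$), and $u(x,\cdot)\in W^{1,\infty}(\epsilon,t)$ for any $x\in\Omega$ and any $0<\epsilon<t\le T$. Then $(D_t^\alpha+\mathcal{L}+c(x,t))u\le0$ in $\Omega\times(0,T]$ implies $u\le0$ in $\bar\Omega\times[0,T]$.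
   Context: $D_t^\alpha$ is the Caputo derivative in time of order $\alpha\in(0,1)$: for $t>0$, $D_t^\alpha u(\cdot,t):=\frac{1}{\Gamma(1-\alpha)}\int_0^t(t-s)^{-\alpha}\,\partial_s u(\cdot,s)\,ds$, where $\Gamma$ is the Gamma function; the integral is understood as $\lim_{\epsilon\to0^+}\int_\epsilon^t$, which exists for functions continuous on $[0,T]$ and in $W^{1,\infty}(\epsilon,t)$ for all $0<\epsilon<t\le T$. No sign condition is imposed on $c$ beyond $c\ge-\lambda$. *)

(* Defs.v *)
From HB Require Import structures.
From mathcomp Require Import all_boot all_order all_algebra.
From mathcomp Require Import all_classical all_reals all_analysis.

Set Implicit Arguments.
Unset Strict Implicit.
Unset Printing Implicit Defensive.

Import Order.TTheory GRing.Theory Num.Theory.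
Import numFieldNormedType.Exports.

Local Open Scope classical_set_scope.
Local Open Scope ring_scope.

Definition Gamma (R : realType) (z : R) : R :=
  \int[@lebesgue_measure R]_(x in `]0, +oo[) (x `^ (z - 1) * expR (- x)).

(* 'rV[R]_d carries the sup norm, which induces the usual topology of R^d; only
   the topology, boundedness and the Lipschitz property are ever used, and all
   three are the same for the Euclidean norm. *)

Definition partial (R : realType) (d : nat) (i : 'I_d) (f : 'rV[R]_d -> R) :
    'rV[R]_d -> R :=
  fun x => 'D_(delta_mx 0 i) f x.

(* C^k(Omega) for an open set Omega *)
Fixpoint Ck (R : realType) (d k : nat) (Omega : set 'rV[R]_d)
    (f : 'rV[R]_d -> R) : Prop :=
  {in Omega, continuous f} /\
  if k is k'.+1 then
    forall i : 'I_d,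
      (forall x, Omega x -> derivable f x (delta_mx 0 i)) /\
      Ck k' Omega (partial i f)
  else True.

Definition boundary (T : topologicalType) (A : set T) : set T :=
  closure A `\` A°.

(* Near each boundary point, Omega lies on one side of the graph of a Lipschitz
   function, in the orthonormal coordinates x *m Q with k-th axis vertical;
   col' k drops the k-th coordinate. *)
Definition lipschitz_boundary (R : realType) (d : nat)
    (Omega : set 'rV[R]_d) : Prop :=
  forall z, boundary Omega z ->
    exists (Q : 'M[R]_d) (k : 'I_d) (g : 'rV[R]_d.-1 -> R) (K : R),
      [/\ Q *m Q^T = 1%:M,
          K.-lipschitz g &
          \forall x \near z,
            Omega x <-> g (col' k (x *m Q)) < (x *m Q) 0 k].

Definition bounded_lipschitz_domain (R : realType) (d : nat)
    (Omega : set 'rV[R]_d) : Prop :=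
  [/\ Omega !=set0, open Omega, connected Omega, bounded_set Omega &
      lipschitz_boundary Omega].

Definition posdef (R : realType) (d : nat) (A : 'M[R]_d) : Prop :=
  forall v : 'rV[R]_d, v != 0 -> 0 < (v *m A *m v^T) 0 0.

(* C_c^oo(]a, b[) *)
Definition test_function (R : realType) (a b : R) (phi : R -> R) : Prop :=
  [/\ forall n x, derivable (derive1n n phi) x 1,
      compact (closure [set x | phi x != 0]) &
      closure [set x | phi x != 0] `<=` `]a, b[].

Definition is_weak_derivative (R : realType) (a b : R) (f g : R -> R) : Prop :=
  locally_integrable `]a, b[ g /\
  forall phi, test_function a b phi ->
    \int[@lebesgue_measure R]_(s in `]a, b[) (f s * derive1 phi s) =
    - \int[@lebesgue_measure R]_(s in `]a, b[) (g s * phi s).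

(* a representative of the weak derivative of f on ]a, b[ (which is unique
   almost everywhere), and 0 if there is none *)
Definition weak_derivative (R : realType) (a b : R) (f : R -> R) : R -> R :=
  xget (cst 0) [set g | is_weak_derivative a b f g].

Definition Linfty (R : realType) (a b : R) (f : R -> R) : Prop :=
  f \_ `]a, b[ \in Lfun (@lebesgue_measure R) +oo%E.

Definition W1infty (R : realType) (a b : R) (f : R -> R) : Prop :=
  Linfty a b f /\ exists2 g, is_weak_derivative a b f g & Linfty a b g.

Definition caputo (R : realType) (alpha : R) (f : R -> R) (t : R) : R :=
  (Gamma (1 - alpha))^-1 *
  lim ((\int[@lebesgue_measure R]_(s in `]eps, t[)
          ((t - s) `^ (- alpha) * weak_derivative eps t f s))
       @[eps --> 0^'+]).

Definition ellipticL (R : realType) (d : nat)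
    (a : 'rV[R]_d -> R -> 'M[R]_d) (b : 'rV[R]_d -> R -> 'rV[R]_d)
    (t : R) (v : 'rV[R]_d -> R) (x : 'rV[R]_d) : R :=
  - (\sum_(i < d) \sum_(j < d)
       partial i (fun y => a y t i j * partial j v y) x)
  + \sum_(i < d) b x t 0 i * partial i v x.

(* Main.v *)
Require Import Defs.
From HB Require Import structures.
From mathcomp Require Import all_boot all_order all_algebra.
From mathcomp Require Import all_classical all_reals all_analysis.
From mathcomp Require Import measurable_realfun ess_sup_inf ring lra.

Set Implicit Arguments.
Unset Strict Implicit.
Unset Printing Implicit Defensive.

Import Order.TTheory GRing.Theory Num.Theory.
Import numFieldNormedType.Exports.

Local Open Scope classical_set_scope.
Local Open Scope ring_scope.

(** The solution is kept nonpositive over successive time steps of a fixed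
    length tau.  Let u <= 0 up to time t0, and suppose that its maximum M over
    the closed domain and the times up to t0 + tau is positive, attained at
    (x, t).  The initial and boundary conditions give x in Omega and t > t0.
    The elliptic part is nonnegative at x, and c u >= - lambda M.  Integrating
    by parts formally, the Caputo derivative of f = u x at t is
      (t ^ (- alpha) (f t - f 0)
        + alpha int_0^t (t - s) ^ (- alpha - 1) (f t - f s) ds)
        / Gamma (1 - alpha),
    where every increment f t - f s is nonnegative and is at least M for s
    before t0.  The weights of the latter add up to (t - t0) ^ (- alpha), which
    is at least tau ^ (- alpha).  When tau is small with respect to lambda, the
    three terms of the equation have a positive sum, a contradiction.  Half of
    M is given away in the proof, to work with increments from an interval
    of times after t0 instead of a limit.

    The integration by parts is never carried out.  The weak derivative g of f
    satisfies int_r^t g = f t - f r ([weak_FTC], obtained from smooth plateau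
    test functions) and is almost everywhere equal to a bounded function
    ([weak_derivative_unique]).  The kernel (t - s) ^ (- alpha) is
    nondecreasing in s, so it is a mixture of indicators of final segments, and
    an integral against it is monotone in the integrals over final segments
    ([nondecreasing_weight_ge0]).  Comparing g with a function concentrated on
    a short interval gives both that the truncated integrals of the Caputo
    derivative form a Cauchy family ([is_cvg_truncated_caputo]) and the lower
    bound for their limit ([caputo_max_ge]).

    For the elliptic part ([ellipticL_at_max]), the symmetric positive definite
    matrix a is W W^T ([posdef_factor]), so at a critical point the second order
    term is a sum of second derivatives along the columns of W, none of which
    is positive at a maximum ([hessian_at_max]). *)

(** * A smooth step *)

Definition smooth (R : realType) (f : R -> R) : Prop :=
  forall n x, derivable (derive1n n f) x 1.

(** Stability of a class under differentiation gives all iterated derivatives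
    at once, so that no formula for them is ever written down. *)
Lemma smooth_coind (R : realType) (S : (R -> R) -> Prop) :
  (forall f, S f -> exists2 g, S g & forall x : R, is_derive x 1 f (g x)) ->
  forall f, S f -> smooth f.
Proof.
move=> SD f Sf n; elim: n f Sf => [|n IH] f /SD[g Sg fg] x.
  by have [] := fg x.
rewrite derive1Sn; suff -> : derive1 f = g by exact: IH.
by apply/funext => y; rewrite derive1E; have [_ ->] := fg y.
Qed.

Lemma smooth_is_derive (R : realType) (f : R -> R) : smooth f ->
  forall x : R, is_derive x 1 f (derive1 f x).
Proof. by move=> sf x; rewrite derive1E; apply: derivableP; exact: (sf 0). Qed.

Lemma smooth_derive1 (R : realType) (f : R -> R) :
  smooth f -> smooth (derive1 f).
Proof. by move=> sf n; rewrite -derive1Sn; exact: sf. Qed.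

Lemma smooth_continuous (R : realType) (f : R -> R) : smooth f -> continuous f.
Proof.
by move=> sf x; apply/differentiable_continuous/derivable1_diffP; exact: (sf 0).
Qed.

Lemma is_derive1_affine (R : realType) (f : R -> R) (k c x df : R) :
  is_derive (k * x + c) 1 f df ->
  is_derive x 1 (fun y => f (k * y + c)) (k * df).
Proof.
move=> fdf; rewrite mulrC.
have : is_derive x 1 (fun y : R => k * y + c) k.
  have d1 := is_deriveZ k (is_derive_id x (1 : R)).
  have d2 := is_deriveD d1 (is_derive_cst c x (1 : R)).
  by apply: is_derive_eq d2 _; rewrite addr0; exact: mulr1.
by move=> ?; exact: (@is_derive1_comp _ f (fun y => k * y + c)).
Qed.

Lemma smooth_affine (R : realType) (f : R -> R) (k c : R) :
  smooth f -> smooth (fun x => f (k * x + c)).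
Proof.
move=> sf.
apply: (@smooth_coind _ (fun h => exists g l, smooth g /\
    h = (fun x => l * g (k * x + c)))); last first.
  by exists f, 1; split => //; apply/funext => x; rewrite mul1r.
move=> _ [g [l [sg ->]]]; exists (fun x => (l * k) * derive1 g (k * x + c)).
  by exists (derive1 g), (l * k); split => //; exact: smooth_derive1.
move=> x; rewrite -mulrA; apply: is_deriveZ.
exact/is_derive1_affine/smooth_is_derive.
Qed.

Lemma smoothB (R : realType) (f g : R -> R) :
  smooth f -> smooth g -> smooth (fun x => f x - g x).
Proof.
move=> sf sg; apply: (@smooth_coind _ (fun h => exists f g,
  [/\ smooth f, smooth g & h = (fun x => f x - g x)])); last by exists f, g.
move=> _ {f g sf sg} [f [g [sf sg ->]]].
exists (fun x => derive1 f x - derive1 g x).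
  by exists (derive1 f), (derive1 g); split => //; exact: smooth_derive1.
by move=> x; apply: is_deriveB; exact: smooth_is_derive.
Qed.

(** The polynomial in the inverse variable makes this family stable under
    differentiation, including at 0. *)
Definition flat (R : realType) (P : {poly R}) (x : R) : R :=
  if 0 < x then P.[x^-1] * expR (- x^-1) else 0.

Lemma flat_le0 (R : realType) (P : {poly R}) (x : R) : x <= 0 -> flat P x = 0.
Proof. by rewrite /flat leNgt => /negbTE ->. Qed.

Lemma flatN (R : realType) (P : {poly R}) (x : R) : flat (- P) x = - flat P x.
Proof. by rewrite /flat; case: ifP => _; rewrite ?oppr0// hornerN mulNr. Qed.

(** The n-th power of the inequality 1 + y / n <= e ^ (y / n). *)
Lemma expn_le_expR (R : realType) (n : nat) :
  exists C : R, forall y : R, 0 <= y -> y ^+ n <= C * expR y.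
Proof.
case: n => [|n].
  exists 1 => y y0; rewrite expr0 mul1r -(expR0 R) ler_expR//.
exists (n.+1%:R ^+ n.+1) => y y0.
have -> : y = n.+1%:R * (y / n.+1%:R) by rewrite mulrCA divff ?mulr1.
rewrite exprMn expRM_natl ler_pM2l; last by rewrite exprn_gt0// ltr0n.
rewrite lerXn2r ?nnegrE ?expR_ge0 ?divr_ge0//.
by rewrite (le_trans _ (expR_ge1Dx _))// lerDr.
Qed.

Lemma poly_le_expR (R : realType) (P : {poly R}) :
  exists2 C : R, 0 <= C & forall y : R, 0 <= y -> `|P.[y]| <= C * expR y.
Proof.
have [C HC] := choice (@expn_le_expR R).
have C0 i : 0 <= C i.
  have := HC i 1 ler01; rewrite expr1n => h.
  have := le_trans ler01 h.
  by rewrite pmulr_lge0// expR_gt0.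
exists (\sum_(i < size P) `|P`_i| * C i).
  by apply: sumr_ge0 => i _; rewrite mulr_ge0.
move=> y y0; rewrite horner_coef (le_trans (ler_norm_sum _ _ _))// mulr_suml.
apply: ler_sum => i _; rewrite normrM -mulrA ler_wpM2l//.
by rewrite ger0_norm ?exprn_ge0// HC.
Qed.

Lemma is_derive_flat (R : realType) (P : {poly R}) (x : R) :
  is_derive x 1 (flat P) (flat ('X^2 * (P - P^`())) x).
Proof.
have [x0|x0|->] := ltgtP x 0.
- rewrite flat_le0; last exact: ltW.
  apply: (@near_eq_is_derive _ _ _ (cst 0)).
    by near=> y; rewrite flat_le0//; apply: ltW; near: y; exact: lt_nbhsl.
- have xN0 : x != 0 by rewrite gt_eqF.
  have dV : is_derive x 1 (fun y : R => y^-1) (- x ^- 2).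
    have h := @is_deriveV R id x 1 1 xN0 (is_derive_id x 1).
    by apply: is_derive_eq h _; exact: mulr1.
  have dP : is_derive x 1 (fun y : R => P.[y^-1]) (P^`().[x^-1] * (- x ^- 2)).
    exact: (@is_derive1_comp _ (horner P) (fun y : R => y^-1)).
  have dN : is_derive x 1 (fun y : R => - y^-1) (x ^- 2).
    rewrite -[x ^- 2]opprK; exact: is_deriveN.
  have dE : is_derive x 1 (fun y : R => expR (- y^-1)) (expR (- x^-1) * x ^- 2).
    exact: (@is_derive1_comp _ expR (fun y : R => - y^-1)).
  have dPE := is_deriveM dP dE.
  have near_flat : \forall y \near x, P.[y^-1] * expR (- y^-1) = flat P y.
    near=> y; rewrite /flat ifT//; near: y; exact: lt_nbhsr.
  apply: is_derive_eq (near_eq_is_derive near_flat dPE) _.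
  rewrite /flat x0 hornerM hornerXn hornerD hornerN.
  rewrite /GRing.scale/= exprVn; ring.
- rewrite flat_le0//.
  (* One factor h^-1 is needed for the difference quotient and a second one to
     gain a factor h, hence the degree is raised by 2. *)
  have [C C0 HC] := poly_le_expR ('X^2 * P).
  suff cv : (fun h : R => h^-1 *: (flat P (h *: 1 + 0) - flat P 0))
    @ 0^' --> (0 : R).
    split; first by apply/cvg_ex; exists 0.
    exact: cvg_lim cv.
  apply/cvgrPdist_le => e e0; near=> h; rewrite sub0r normrN.
  rewrite [flat P 0]flat_le0// subr0 addr0 [h *: 1]mulr1.
  have [h0|h0] := leP h 0; first by rewrite flat_le0// scaler0 normr0 ltW.
  have hN0 : h != 0 by rewrite gt_eqF.
  rewrite /flat h0 /GRing.scale/=.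
  have := HC h^-1; rewrite invr_ge0 (ltW h0) => /(_ isT).
  rewrite hornerM hornerXn => hC.
  have -> : h^-1 * (P.[h^-1] * expR (- h^-1)) =
    h * (h^-1 ^+ 2 * P.[h^-1] * expR (- h^-1)) by field.
  rewrite normrM (gtr0_norm h0) normrM [`|expR _|]gtr0_norm ?expR_gt0//.
  have : `|h^-1 ^+ 2 * P.[h^-1]| * expR (- h^-1) <= C.
    rewrite expRN -ler_pdivlMr ?invr_gt0 ?expR_gt0// invrK//.
  move=> /(ler_wpM2l (ltW h0)) /le_trans; apply.
  have : h <= e / (C + 1).
    rewrite (le_trans (ler_norm h))//; near: h; apply: dnbhs0_le.
    by rewrite divr_gt0// ltr_wpDl.
  rewrite ler_pdivlMr; last by rewrite ltr_wpDl.
  by apply: le_trans; rewrite ler_wpM2l ?(ltW h0)// lerDl.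
Unshelve. all: by end_near. Qed.

(** The standard smooth transition from 0 to 1, which takes place on [0, 1]. *)
Definition step (R : realType) (x : R) : R :=
  flat 1 x * (flat 1 x + flat 1 (1 - x))^-1.

Lemma flat1_ge0 (R : realType) (x : R) : 0 <= flat 1 x.
Proof. by rewrite /flat; case: ifP => // _; rewrite hornerC mul1r expR_ge0. Qed.

Lemma flat1_gt0 (R : realType) (x : R) : 0 < x -> 0 < flat 1 x.
Proof. by rewrite /flat => ->; rewrite hornerC mul1r expR_gt0. Qed.

Lemma flatX2_ge0 (R : realType) (x : R) : 0 <= flat 'X^2 x.
Proof.
rewrite /flat; case: ifP => // _.
by rewrite hornerXn mulr_ge0 ?expR_ge0// exprn_even_ge0.
Qed.

Lemma step_denom_gt0 (R : realType) (x : R) : 0 < flat 1 x + flat 1 (1 - x).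
Proof.
have [x0|x0] := leP x 0.
  by rewrite ltr_wpDl ?flat1_ge0// flat1_gt0// subr_gt0 (le_lt_trans x0).
by rewrite ltr_pwDl ?flat1_ge0// flat1_gt0.
Qed.

(** An algebra that contains [step] and is stable under differentiation: the
    derivative of the reciprocal is a combination of its own square with
    functions of the first two kinds. *)
Inductive step_alg (R : realType) : (R -> R) -> Prop :=
| step_alg_l P : step_alg (flat P)
| step_alg_r P : step_alg (fun x => flat P (1 - x))
| step_alg_inv : step_alg (fun x => (flat 1 x + flat 1 (1 - x))^-1)
| step_alg_add f g : step_alg f -> step_alg g -> step_alg (fun x => f x + g x)
| step_alg_mul f g : step_alg f -> step_alg g -> step_alg (fun x => f x * g x).

Lemma is_derive_flat_onem (R : realType) (P : {poly R}) (x : R) :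
  is_derive x 1 (fun x => flat P (1 - x))
    (flat (- ('X^2 * (P - P^`()))) (1 - x)).
Proof.
have := @is_derive1_affine R (flat P) (-1) 1 x _ (is_derive_flat P _).
rewrite (_ : (fun y : R => _) = (fun x => flat P (1 - x))); last first.
  by apply/funext => y; rewrite mulN1r addrC.
move=> h; apply: is_derive_eq h _; rewrite !mulN1r.
by rewrite [- x + 1]addrC flatN.
Qed.

Lemma is_derive_step_denom (R : realType) (x : R) :
  is_derive x 1 (fun x : R => (flat 1 x + flat 1 (1 - x))^-1)
    (flat (- 'X^2) x * ((flat 1 x + flat 1 (1 - x))^-1 *
     (flat 1 x + flat 1 (1 - x))^-1) +
     flat 'X^2 (1 - x) * ((flat 1 x + flat 1 (1 - x))^-1 *
     (flat 1 x + flat 1 (1 - x))^-1)).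
Proof.
have N0 : flat 1 x + flat 1 (1 - x) != 0 by rewrite gt_eqF// step_denom_gt0.
have E : 'X^2 * (1 - 1^`()) = 'X^2 :> {poly R} by rewrite derivC subr0 mulr1.
have d1 := is_derive_flat 1 x; have d2 := is_derive_flat_onem 1 x.
have d3 : is_derive x 1 (fun x : R => flat 1 x + flat 1 (1 - x)) _ :=
  is_deriveD d1 d2.
have d4 := is_deriveV (f := fun x : R => flat 1 x + flat 1 (1 - x)) N0 d3.
apply: is_derive_eq d4 _.
by rewrite !E !flatN -exprVn /GRing.scale/=; ring.
Qed.

Lemma step_alg_derive (R : realType) (f : R -> R) : step_alg f ->
  exists2 g, step_alg g & forall x : R, is_derive x 1 f (g x).
Proof.
elim => [P|P||{}f g af [f' af' df] ag [g' ag' dg]|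
  {}f g af [f' af' df] ag [g' ag' dg]].
- by exists (flat ('X^2 * (P - P^`()))); [constructor|exact: is_derive_flat].
- exists (fun x => flat (- ('X^2 * (P - P^`()))) (1 - x)); first by constructor.
  exact: is_derive_flat_onem.
- have inv2 := step_alg_mul (step_alg_inv R) (step_alg_inv R).
  eexists; last exact: is_derive_step_denom.
  exact: (step_alg_add (step_alg_mul (step_alg_l (- 'X^2)) inv2)
                       (step_alg_mul (step_alg_r 'X^2) inv2)).
- exists (fun x => f' x + g' x); first exact: step_alg_add.
  by move=> x; exact: is_deriveD.
- exists (fun x => f x * g' x + g x * f' x).
    by apply: step_alg_add; exact: step_alg_mul.
  by move=> x; exact: is_deriveM.
Qed.

Lemma smooth_step (R : realType) : smooth (@step R).
Proof.
apply: (@smooth_coind _ (@step_alg R)); first exact: step_alg_derive.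
exact: (step_alg_mul (step_alg_l 1) (step_alg_inv R)).
Qed.

Lemma step_le0 (R : realType) (x : R) : x <= 0 -> step x = 0.
Proof. by move=> x0; rewrite /step flat_le0// mul0r. Qed.

Lemma step_ge1 (R : realType) (x : R) : 1 <= x -> step x = 1.
Proof.
move=> x1; rewrite /step [flat 1 (1 - x)]flat_le0 ?subr_le0// addr0 divff//.
by rewrite gt_eqF// flat1_gt0// (lt_le_trans ltr01).
Qed.

Lemma derive1_step_ge0 (R : realType) (x : R) : 0 <= derive1 (@step R) x.
Proof.
have d1 := is_derive_flat 1 x; have d2 := is_derive_step_denom x.
have d3 := is_deriveM d1 d2.
rewrite derive1E; have [_ ->] := d3.
rewrite derivC subr0 mulr1.
rewrite flatN.
have := step_denom_gt0 x; have := flat1_ge0 x; have := flat1_ge0 (1 - x).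
have := flatX2_ge0 x; have := flatX2_ge0 (1 - x).
move: (flat 'X^2 _) (flat 'X^2 _) (flat 1 _) (flat 1 _) => p q a b.
move=> p0 q0 a0 b0 ab; rewrite /GRing.scale/=.
have -> : a * (- p * ((a + b)^-1 * (a + b)^-1) +
  q * ((a + b)^-1 * (a + b)^-1)) + (a + b)^-1 * p =
  (a * q + b * p) * ((a + b)^-1 * (a + b)^-1).
  by field; rewrite gt_eqF.
by rewrite mulr_ge0// ?addr_ge0// mulr_ge0// ?invr_ge0 ltW.
Qed.

Lemma step_ge0_le1 (R : realType) (x : R) : 0 <= step x <= 1.
Proof.
have d0 := step_denom_gt0 x.
rewrite /step; apply/andP; split; first by rewrite divr_ge0 ?flat1_ge0// ltW.
by rewrite ler_pdivrMr// mul1r lerDl flat1_ge0.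
Qed.

(** * The fundamental theorem of calculus for weak derivatives *)

Lemma integrable_within_oo (R : realType) (a b : R) (f : R -> R) :
  {within `[a, b], continuous f} ->
  (@lebesgue_measure R).-integrable `]a, b[ (EFin \o f).
Proof.
move=> cf.
have := continuous_compact_integrable (segment_compact (a := a) (b := b)) cf.
by apply: integrableS => //; exact: subset_itv_oo_cc.
Qed.

Lemma dominated_Rintegral_cvg (R : realType) (D : set R) (f_ : nat -> R -> R)
    (f g : R -> R) : measurable D ->
  (forall n, measurable_fun D (f_ n)) -> measurable_fun D f ->
  (forall x, D x -> f_ ^~ x @ \oo --> f x) ->
  (@lebesgue_measure R).-integrable D (EFin \o g) ->
  (forall n x, D x -> `|f_ n x| <= g x) ->
  (\int[@lebesgue_measure R]_(x in D) f_ n x) @[n --> \oo] -->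
  \int[@lebesgue_measure R]_(x in D) f x.
Proof.
move=> mD mf_ mf cf ig fg.
have [|||||i1 _ i2] := @dominated_convergence _ _ _ (@lebesgue_measure R) D mD
  (fun n => EFin \o f_ n) (EFin \o f) (EFin \o g).
- by move=> n; apply/measurable_EFinP; exact: mf_.
- by apply/measurable_EFinP.
- by apply: aeW => x Dx; apply: cvg_EFin; [exact: nearW|exact: cf].
- by [].
- by apply: aeW => x n Dx; rewrite lee_fin; exact: fg.
rewrite /Rintegral; apply: fine_cvg; rewrite fineK//.
exact: integrable_fin_num.
Qed.

Lemma Rintegral_derive1_oo (R : realType) (a b : R) (f : R -> R) : a < b ->
  smooth f ->
  \int[@lebesgue_measure R]_(x in `]a, b[) derive1 f x = f b - f a.
Proof.
move=> ab sf.
have cf' : {within `[a, b], continuous (derive1 f)}.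
  by apply: continuous_subspaceT; exact/smooth_continuous/smooth_derive1.
have i1 := integrable_within_oo cf'.
have i2 : (@lebesgue_measure R).-integrable `]a, b] (EFin \o derive1 f).
  have := continuous_compact_integrable (segment_compact (a := a) (b := b)) cf'.
  by apply: integrableS => //; exact: subset_itv_oc_cc.
rewrite Rintegral_itv_bndo_bndc// Rintegral_itv_obnd_cbnd//.
rewrite /Rintegral (@continuous_FTC2 _ (derive1 f) f)//.
have cf := smooth_continuous sf.
split; first by move=> x _; exact: (sf 0).
- by apply: cvg_at_right_filter; exact: cf.
- by apply: cvg_at_left_filter; exact: cf.
Qed.

Lemma derive1_step_lt0 (R : realType) (x : R) :
  x < 0 -> derive1 (@step R) x = 0.
Proof.
move=> x0; rewrite derive1E (@near_eq_derive _ _ _ _ (cst (0 : R))) ?derive_cst//.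
near=> y; rewrite step_le0//; apply: ltW; near: y; exact: lt_nbhsl.
Unshelve. all: by end_near. Qed.

Lemma derive1_step_gt1 (R : realType) (x : R) :
  1 < x -> derive1 (@step R) x = 0.
Proof.
move=> x1; rewrite derive1E (@near_eq_derive _ _ _ _ (cst (1 : R))) ?derive_cst//.
near=> y; rewrite step_ge1//; apply: ltW; near: y; exact: lt_nbhsr.
Unshelve. all: by end_near. Qed.

(** Integrating against the derivative of a transition from 0 to 1 samples the
    function where the transition takes place. *)
Lemma Rintegral_transition (R : realType) (a b c e : R) (f eta : R -> R) :
  a < b -> {within `[a, b], continuous f} -> smooth eta ->
  (forall x, 0 <= derive1 eta x) -> eta a = 0 -> eta b = 1 ->
  (forall s, a < s < b -> derive1 eta s != 0 -> `|f s - f c| <= e) ->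
  `|\int[@lebesgue_measure R]_(s in `]a, b[) (f s * derive1 eta s) - f c| <= e.
Proof.
move=> ab cf seta eta0 etaa etab fe.
have ceta : {within `[a, b], continuous (derive1 eta)}.
  by apply: continuous_subspaceT; exact/smooth_continuous/smooth_derive1.
have cfeta : {within `[a, b], continuous (fun s => f s * derive1 eta s)}.
  by move=> x; apply: continuousM; [exact: cf|exact: ceta].
have i1 := integrable_within_oo ceta.
have i2 := integrable_within_oo cfeta.
have I1 := Rintegral_derive1_oo ab seta.
have i3 (k : R) : (@lebesgue_measure R).-integrable `]a, b[
    (EFin \o (fun s => k * derive1 eta s)).
  exact: (integrableZl _ k i1).
rewrite ler_distl.
have -> : f c - e = (f c - e) * (eta b - eta a) by rewrite etaa etab subr0 mulr1.
have -> : f c + e = (f c + e) * (eta b - eta a) by rewrite etaa etab subr0 mulr1.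
rewrite -I1 -!RintegralZl//.
apply/andP; split; apply: le_Rintegral => // s; rewrite /= in_itv/= => sab;
have [->|N0] := eqVneq (derive1 eta s) 0; rewrite ?mulr0// ler_wpM2r//;
  have := fe _ sab N0; rewrite ler_distlC => /andP[]; lra.
Qed.

(** A test function that rises on [a + d, a + 2 d] and falls on
    [b - 2 d, b - d]; the margins of width d keep its support compact in the
    open interval. *)
Definition plateau (R : realType) (a b d : R) (s : R) : R :=
  step (d^-1 * s + (- a / d - 1)) - step (d^-1 * s + (2 - b / d)).

Section plateau.
Context (R : realType) (a b d : R).

Let up (s : R) : R := step (d^-1 * s + (- a / d - 1)).
Let down (s : R) : R := step (d^-1 * s + (2 - b / d)).

Let upE s : 0 < d -> d^-1 * s + (- a / d - 1) = (s - a - d) / d.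
Proof. by move=> d0; field; rewrite gt_eqF. Qed.

Let downE s : 0 < d -> d^-1 * s + (2 - b / d) = (s - b + 2 * d) / d.
Proof. by move=> d0; field; rewrite gt_eqF. Qed.

Lemma plateau_left (s : R) : 0 < d -> 4 * d < b - a ->
  s <= a + d -> plateau a b d s = 0.
Proof.
move=> d0 dab sa; rewrite /plateau upE// downE// !step_le0 ?subr0//.
  by rewrite ler_pdivrMr// mul0r; lra.
by rewrite ler_pdivrMr// mul0r; lra.
Qed.

Lemma plateau_right (s : R) : 0 < d -> 4 * d < b - a ->
  b - d <= s -> plateau a b d s = 0.
Proof.
move=> d0 dab sa; rewrite /plateau upE// downE// !step_ge1 ?subrr//.
  by rewrite ler_pdivlMr// mul1r; lra.
by rewrite ler_pdivlMr// mul1r; lra.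
Qed.

Lemma plateau_middle (s : R) : 0 < d -> 4 * d < b - a ->
  a + 2 * d <= s <= b - 2 * d -> plateau a b d s = 1.
Proof.
move=> d0 dab /andP[sa sb]; rewrite /plateau upE// downE// step_ge1 ?step_le0 ?subr0//.
  by rewrite ler_pdivrMr// mul0r; lra.
by rewrite ler_pdivlMr// mul1r; lra.
Qed.

Lemma normr_plateau_le1 (s : R) : `|plateau a b d s| <= 1.
Proof.
rewrite /plateau; have /andP[] := step_ge0_le1 (d^-1 * s + (- a / d - 1)).
have /andP[] := step_ge0_le1 (d^-1 * s + (2 - b / d)).
by rewrite ler_norml; lra.
Qed.

Let smooth_up : smooth up. Proof. exact/smooth_affine/smooth_step. Qed.
Let smooth_down : smooth down. Proof. exact/smooth_affine/smooth_step. Qed.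

Lemma smooth_plateau : smooth (plateau a b d).
Proof. exact: smoothB smooth_up smooth_down. Qed.

Lemma test_function_plateau : 0 < d -> 4 * d < b - a ->
  test_function a b (plateau a b d).
Proof.
move=> d0 dab.
have sub : closure [set x | plateau a b d x != 0] `<=` `[a + d, b - d].
  rewrite closureE; apply: smallest_sub; first exact: interval_closed.
  move=> x /= px; rewrite in_itv/= !leNgt; apply/andP; split; apply/negP.
    by move=> /ltW /(plateau_left d0 dab) p0; rewrite p0 eqxx in px.
  by move=> /ltW /(plateau_right d0 dab) p0; rewrite p0 eqxx in px.
split.
- exact: smooth_plateau.
- apply: subclosed_compact sub; first exact: closed_closure.
  exact: segment_compact.
- apply: subset_trans sub _ => x /=; rewrite !in_itv/= => /andP[? ?].
  by apply/andP; split; lra.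
Qed.

Let derive1_up s : 0 < d -> derive1 up s = d^-1 * derive1 (@step R) ((s - a - d) / d).
Proof.
move=> d0; rewrite [LHS]derive1E -upE//.
by have [_ ->] := is_derive1_affine
  (smooth_is_derive (@smooth_step R) (d^-1 * s + (- a / d - 1))).
Qed.

Let derive1_down s : 0 < d ->
  derive1 down s = d^-1 * derive1 (@step R) ((s - b + 2 * d) / d).
Proof.
move=> d0; rewrite [LHS]derive1E -downE//.
by have [_ ->] := is_derive1_affine
  (smooth_is_derive (@smooth_step R) (d^-1 * s + (2 - b / d))).
Qed.

(** The derivative is a difference of two transitions, one near a and one near
    b. *)
Lemma Rintegral_derive1_plateau (f : R -> R) (e : R) :
  0 < d -> 4 * d < b - a ->
  {within `[a, b], continuous f} ->
  (forall s, a <= s <= a + 2 * d -> `|f s - f a| <= e) ->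
  (forall s, b - 2 * d <= s <= b -> `|f s - f b| <= e) ->
  `|\int[@lebesgue_measure R]_(s in `]a, b[)
      (f s * derive1 (plateau a b d) s) - (f a - f b)| <= 2 * e.
Proof.
move=> d0 dab cf fa fb.
have ab : a < b by lra.
have d'0 : 0 <= d^-1 by rewrite invr_ge0 ltW.
have Iup : `|\int[@lebesgue_measure R]_(s in `]a, b[) (f s * derive1 up s)
    - f a| <= e.
  apply: Rintegral_transition => //.
  - by move=> x; rewrite derive1_up// mulr_ge0// derive1_step_ge0.
  - by rewrite /up upE// step_le0// ler_pdivrMr// mul0r; lra.
  - by rewrite /up upE// step_ge1// ler_pdivlMr// mul1r; lra.
  - move=> s /andP[as_ sb]; rewrite derive1_up// => N0; apply: fa.
    rewrite (ltW as_)/= leNgt; apply/negP => sa.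
    by rewrite derive1_step_gt1 ?mulr0 ?eqxx// ?ltr_pdivlMr ?mul1r in N0; lra.
have Idown : `|\int[@lebesgue_measure R]_(s in `]a, b[) (f s * derive1 down s)
    - f b| <= e.
  apply: Rintegral_transition => //.
  - by move=> x; rewrite derive1_down// mulr_ge0// derive1_step_ge0.
  - by rewrite /down downE// step_le0// ler_pdivrMr// mul0r; lra.
  - by rewrite /down downE// step_ge1// ler_pdivlMr// mul1r; lra.
  - move=> s /andP[as_ sb]; rewrite derive1_down// => N0; apply: fb.
    rewrite (ltW sb) andbT leNgt; apply/negP => sa.
    by rewrite derive1_step_lt0 ?mulr0 ?eqxx// ?ltr_pdivrMr ?mul0r in N0; lra.
have i h : smooth h -> (@lebesgue_measure R).-integrable `]a, b[
    (EFin \o (fun s => f s * derive1 h s)).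
  move=> sh; apply: integrable_within_oo => x.
  apply: continuousM; first exact: cf.
  by apply: continuous_subspaceT; exact/smooth_continuous/smooth_derive1.
have -> : \int[@lebesgue_measure R]_(s in `]a, b[)
      (f s * derive1 (plateau a b d) s) =
    \int[@lebesgue_measure R]_(s in `]a, b[) (f s * derive1 up s) -
    \int[@lebesgue_measure R]_(s in `]a, b[) (f s * derive1 down s).
  rewrite -RintegralB//; [|exact: i..].
  apply: eq_Rintegral => s _; rewrite -mulrBr; congr (_ * _).
  rewrite derive1E.
  by have [_ ->] := is_deriveB (smooth_is_derive smooth_up s)
    (smooth_is_derive smooth_down s).
rewrite opprD addrACA -opprD.
rewrite (le_trans (ler_normB _ _))//.
by rewrite mulr_natl mulr2n lerD.
Qed.

End plateau.

(** Test functions that converge to the indicator of the interval turn the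
    defining identity of the weak derivative into the fundamental theorem. *)
Lemma weak_FTC (R : realType) (a b : R) (f g : R -> R) : a < b ->
  {within `[a, b], continuous f} ->
  (@lebesgue_measure R).-integrable `]a, b[ (EFin \o g) ->
  (forall phi, test_function a b phi ->
    \int[@lebesgue_measure R]_(s in `]a, b[) (f s * derive1 phi s) =
    - \int[@lebesgue_measure R]_(s in `]a, b[) (g s * phi s)) ->
  \int[@lebesgue_measure R]_(s in `]a, b[) g s = f b - f a.
Proof.
move=> ab cf ig fg.
(* n.+2, as 4 * d n must be strictly less than b - a already for n = 0. *)
pose d n := (b - a) / (4 * n.+2%:R).
have d0 n : 0 < d n by rewrite divr_gt0 ?subr_gt0 ?mulr_gt0.
have dab n : 4 * d n < b - a.
  have -> : 4 * d n = (b - a) / n.+2%:R.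
    by rewrite /d invfM mulrCA [4 * _]mulrA divff ?mul1r.
  by rewrite ltr_pdivrMr// ltr_pMr ?subr_gt0// ltr1n.
have dcv e : 0 < e -> \forall n \near \oo, 2 * d n <= e.
  move=> e0; near=> n.
  rewrite /d mulrA ler_pdivrMr ?mulr_gt0//.
  have : harmonic n <= e / (b - a).
    near: n; apply: (cvgr_le _ (@cvg_harmonic R)).
    by rewrite divr_gt0// subr_gt0.
  rewrite /harmonic/= ler_pdivlMr ?subr_gt0// mulrC ler_pdivrMr//.
  have : n.+1%:R <= n.+2%:R :> R by rewrite ler_nat.
  have : (0 : R) < n.+1%:R by [].
  by move: (n.+1%:R : R) (n.+2%:R : R) => x y x0 xy; nra.
have mg : measurable_fun `]a, b[ g.
  by apply/measurable_EFinP; exact: measurable_int ig.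
have c1 : (\int[@lebesgue_measure R]_(s in `]a, b[) (g s * plateau a b (d n) s))
    @[n --> \oo] --> \int[@lebesgue_measure R]_(s in `]a, b[) g s.
  apply: (@dominated_Rintegral_cvg _ _ _ _ (fun s => `|g s|)) => //.
  - move=> n; apply: measurable_funM => //.
    apply: measurable_funS (continuous_measurable_fun _) => //.
    exact/smooth_continuous/smooth_plateau.
  - move=> s; rewrite /= in_itv/= => /andP[as_ sb].
    apply: cvg_near_cst; near=> n.
    rewrite plateau_middle ?mulr1//.
    have : 2 * d n <= s - a.
      by near: n; apply: dcv; rewrite subr_gt0.
    have : 2 * d n <= b - s.
      by near: n; apply: dcv; rewrite subr_gt0.
    by move: (d n) => x ? ?; apply/andP; split; lra.
  - exact: integrable_norm.
  - move=> n s _; rewrite normrM ler_piMr//.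
    exact: normr_plateau_le1.
have c2 : (\int[@lebesgue_measure R]_(s in `]a, b[)
    (f s * derive1 (plateau a b (d n)) s)) @[n --> \oo] --> f a - f b.
  apply/cvgrPdist_le => e e0.
  have /continuous_within_itvP := cf => /(_ ab)[_ fa fb].
  have e20 : 0 < e / 2 by rewrite divr_gt0.
  have [da da0 Hda] : exists2 r : R, 0 < r &
      forall s, a <= s <= a + r -> `|f s - f a| <= e / 2.
    move: fa => /cvgrPdist_le/(_ _ e20)[r /= r0 Hr].
    exists (r / 2); first by rewrite divr_gt0.
    move=> s /andP[]; rewrite le_eqVlt => /predU1P[<- _|as_ sr].
      by rewrite subrr normr0 ltW.
    rewrite distrC; apply: Hr => //=.
    by rewrite ltr_norml; apply/andP; split; lra.
  have [db db0 Hdb] : exists2 r : R, 0 < r &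
      forall s, b - r <= s <= b -> `|f s - f b| <= e / 2.
    move: fb => /cvgrPdist_le/(_ _ e20)[r /= r0 Hr].
    exists (r / 2); first by rewrite divr_gt0.
    move=> s /andP[sr]; rewrite le_eqVlt => /predU1P[->|sb].
      by rewrite subrr normr0 ltW.
    rewrite distrC; apply: Hr => //=.
    by rewrite ltr_norml; apply/andP; split; lra.
  near=> n; rewrite distrC.
  have -> : e = 2 * (e / 2) by field.
  have dna : 2 * d n <= da.
    by near: n; exact: dcv.
  have dnb : 2 * d n <= db.
    by near: n; exact: dcv.
  apply: Rintegral_derive1_plateau => //.
    by move=> s /andP[? ?]; apply: Hda; apply/andP; split; lra.
  by move=> s /andP[? ?]; apply: Hdb; apply/andP; split; lra.
have : (- \int[@lebesgue_measure R]_(s in `]a, b[)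
    (f s * derive1 (plateau a b (d n)) s)) @[n --> \oo] --> - (f a - f b).
  exact: cvgN.
under eq_fun => n do
  rewrite (fg _ (test_function_plateau (d0 n) (dab n))) opprK.
move=> /(cvg_unique _ c1) ->//.
by rewrite opprB.
Unshelve. all: by end_near. Qed.

(** * Uniqueness and boundedness of the weak derivative *)

Lemma locally_integrable_sub_itv (R : realType) (a b p q : R) (h : R -> R) :
  locally_integrable `]a, b[ h -> a < p -> q < b ->
  (@lebesgue_measure R).-integrable `]p, q[ (EFin \o h).
Proof.
move=> [mh _ lh] ap qb.
apply: (@integrableS _ _ _ (@lebesgue_measure R) `[p, q]) => //.
  exact: subset_itv_oo_cc.
have pqab : `[p, q] `<=` `]a, b[.
  move=> x /=; rewrite !in_itv/= => /andP[? ?].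
  by apply/andP; split; [exact: lt_le_trans ap _|exact: le_lt_trans qb].
apply/integrableP; split.
  by apply/measurable_EFinP; exact: measurable_funS mh.
by under eq_integral do rewrite /=; apply: lh => //; exact: segment_compact.
Qed.

(** By the Lebesgue form of the fundamental theorem of calculus, h is almost
    everywhere the derivative of its indefinite integral, which vanishes. *)
Lemma Rintegral_itv_eq0_ae (R : realType) (a b : R) (h : R -> R) :
  locally_integrable `]a, b[ h ->
  (forall p q, a < p -> p < q -> q < b ->
    \int[@lebesgue_measure R]_(s in `]p, q[) h s = 0) ->
  {ae @lebesgue_measure R, forall x, `]a, b[%classic x -> h x = 0}.
Proof.
move=> lh h0.
have ih p q : a < p -> q < b ->
    (@lebesgue_measure R).-integrable `]p, q[ (EFin \o h).
  exact: locally_integrable_sub_itv.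
have h0' p q : a < p -> q < b ->
    {ae @lebesgue_measure R, forall x, `]p, q[%classic x -> h x = 0}.
  move=> ap qb.
  have i1 : (@lebesgue_measure R).-integrable setT (EFin \o (h \_ `]p, q[)).
    by rewrite -restrict_EFin; apply/(integrable_mkcond _ _).1 => //; exact: ih.
  have i2 y : (@lebesgue_measure R).-integrable `]-oo, y]
      (EFin \o (h \_ `]p, q[)) by apply: integrableS i1.
  have l1 := integrable_locally (measurable_itv `]p, q[) (ih _ _ ap qb).
  have := FTC1Ny i2 l1.
  apply: filterS; first exact: (ae_filter_ringOfSetsType (@lebesgue_measure R)).
  move=> x [_ hx] xpq.
  rewrite patchE mem_set// in hx; rewrite -hx.
  rewrite (_ : (fun y : R => _) = cst 0) ?derive1_cst//.
  apply/funext => y; rewrite -Rintegral_mkcondr.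
  have [yp|py] := leP y p.
    rewrite (_ : _ `&` _ = set0) ?Rintegral_set0//.
    apply/seteqP; split => // z [] /=; rewrite !in_itv/= => zy /andP[pz _].
    by move: (lt_le_trans pz (le_trans zy yp)); rewrite ltxx.
  have [qy|yq] := leP q y.
    rewrite (_ : _ `&` _ = `]p, q[%classic); last first.
      apply/seteqP; split => [z []//|z] /=; rewrite !in_itv/= => /andP[pz zq].
      by rewrite pz zq (le_trans (ltW zq)).
    have [pq|qp] := ltP p q; first exact: h0.
    by rewrite set_itv_ge ?Rintegral_set0// bnd_simp -leNgt.
  rewrite (_ : _ `&` _ = `]p, y]%classic); last first.
    apply/seteqP; split => [z []|z] /=; rewrite !in_itv/=.
      by move=> -> /andP[->].
    by move=> /andP[-> zy]; rewrite zy (le_lt_trans zy).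
  rewrite -Rintegral_itv_bndo_bndc; last exact: ih (lt_trans yq qb).
  by apply: h0 => //; exact: lt_trans yq qb.
pose d n : R := n.+1%:R^-1.
have d0 n : 0 < d n by rewrite invr_gt0.
have hn n : {ae @lebesgue_measure R, forall x,
    `]a + d n, b - d n[%classic x -> h x = 0}.
  by apply: h0'; rewrite ?ltrDl// ltrBlDr ltrDl.
have : {ae @lebesgue_measure R, forall x n,
    `]a + d n, b - d n[%classic x -> h x = 0} by exact: ae_foralln.
apply: filterS; first exact: (ae_filter_ringOfSetsType (@lebesgue_measure R)).
move=> x hx /=; rewrite in_itv/= => /andP[ax xb].
have [n [an bn]] : exists n, d n < x - a /\ d n < b - x.
  near \oo => n; exists n; split; near: n.
    by apply: (cvgr_lt _ (@cvg_harmonic R)); rewrite subr_gt0.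
  by apply: (cvgr_lt _ (@cvg_harmonic R)); rewrite subr_gt0.
by apply: (hx n); rewrite /= in_itv/= -ltrBrDl an ltrBrDr -ltrBrDl.
Unshelve. all: by end_near. Qed.

(** A test function of the smaller interval is one of the larger interval, and
    its derivative vanishes outside of its support. *)
Lemma weak_derivative_sub (R : realType) (a b p q : R) (f g : R -> R) :
  a <= p -> q <= b ->
  (forall phi, test_function a b phi ->
    \int[@lebesgue_measure R]_(s in `]a, b[) (f s * derive1 phi s) =
    - \int[@lebesgue_measure R]_(s in `]a, b[) (g s * phi s)) ->
  forall phi, test_function p q phi ->
    \int[@lebesgue_measure R]_(s in `]p, q[) (f s * derive1 phi s) =
    - \int[@lebesgue_measure R]_(s in `]p, q[) (g s * phi s).
Proof.
move=> ap qb fg phi [sphi cphi spq].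
have pqab : `]p, q[ `<=` `]a, b[.
  move=> x /=; rewrite !in_itv/= => /andP[px xq].
  by rewrite (le_lt_trans ap px) (lt_le_trans xq qb).
have restr (k h : R -> R) : (forall x, ~ closure [set x | phi x != 0] x -> h x = 0) ->
    \int[@lebesgue_measure R]_(s in `]p, q[) (k s * h s) =
    \int[@lebesgue_measure R]_(s in `]a, b[) (k s * h s).
  move=> h0; rewrite Rintegral_mkcond [RHS]Rintegral_mkcond.
  congr Rintegral; apply/funext => x; rewrite !patchE.
  have [xpq|xpq] := boolP (x \in _).
    by rewrite mem_set//; apply: pqab; rewrite inE in xpq.
  case: ifPn => // _; rewrite h0 ?mulr0// => /spq xpq'.
  by move: xpq; rewrite mem_set.
rewrite !restr; last 2 first.
- move=> x xphi; apply/eqP.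
  by apply: contra_notT xphi => ?; apply: subset_closure.
- move=> x xphi; rewrite derive1E (@near_eq_derive _ _ _ _ (cst (0 : R))).
    by rewrite derive_cst.
  have : open (~` closure [set x | phi x != 0]).
    exact/closed_openC/closed_closure.
  move=> /(_ _ xphi); apply: filterS => y yphi.
  by apply/eqP; apply: contra_notT yphi; by move=> ?; apply: subset_closure.
apply: fg; split => //.
exact: subset_trans pqab.
Qed.

Lemma weak_derivative_unique (R : realType) (a b : R) (f g g' : R -> R) :
  {within `[a, b], continuous f} ->
  is_weak_derivative a b f g -> is_weak_derivative a b f g' ->
  {ae @lebesgue_measure R, forall x, `]a, b[%classic x -> g x = g' x}.
Proof.
move=> cf [lg fg] [lg' fg'].
have : {ae @lebesgue_measure R, forall x, `]a, b[%classic x -> (g \- g') x = 0}.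
  apply: Rintegral_itv_eq0_ae; first exact: locally_integrableB.
  move=> p q ap pq qb.
  have cf' : {within `[p, q], continuous f}.
    apply: continuous_subspaceW cf => x /=; rewrite !in_itv/= => /andP[px xq].
    by rewrite (le_trans (ltW ap) px) (le_trans xq (ltW qb)).
  have ig := locally_integrable_sub_itv lg ap qb.
  have ig' := locally_integrable_sub_itv lg' ap qb.
  rewrite RintegralB// (weak_FTC pq cf' ig); last first.
    by apply: weak_derivative_sub fg; exact: ltW.
  rewrite (weak_FTC pq cf' ig') ?subrr//.
  by apply: weak_derivative_sub fg'; exact: ltW.
apply: filterS; first exact: (ae_filter_ringOfSetsType (@lebesgue_measure R)).
by move=> x hx xab; apply/eqP; rewrite -subr_eq0; apply/eqP; exact: hx.
Qed.

Lemma Linfty_ae_bounded (R : realType) (a b : R) (g : R -> R) : Linfty a b g ->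
  exists C : R,
    {ae @lebesgue_measure R, forall x, `]a, b[%classic x -> `|g x| <= C}.
Proof.
rewrite /Linfty inE => /andP[_]; rewrite inE/= /finite_norm unlock.
have muT : (0 < @lebesgue_measure R [set: R])%E.
  apply: (@lt_le_trans _ _ (@lebesgue_measure R `[0, 1]%classic)).
    by rewrite lebesgue_measure_itv/= lte_fin ltr01 sube0 lte_fin.
  by apply: le_measure; rewrite ?inE.
rewrite muT => /ess_supr_bounded[C HC]; exists C.
move: HC; apply: filterS.
by move=> x /= + xab; rewrite patchE mem_set.
Qed.

(** The chosen weak derivative need not be the bounded one, but agrees with it
    almost everywhere. *)
Lemma W1infty_weak_derivative (R : realType) (a b : R) (f : R -> R) :
  {within `[a, b], continuous f} -> W1infty a b f ->
  is_weak_derivative a b f (weak_derivative a b f) /\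
  exists C : R, {ae @lebesgue_measure R, forall x, `]a, b[%classic x ->
    `|weak_derivative a b f x| <= C}.
Proof.
move=> cf [_ [g fg /Linfty_ae_bounded[C gC]]].
have fw : is_weak_derivative a b f (weak_derivative a b f).
  rewrite /weak_derivative; case: xgetP => [h _ //|/(_ g)]; exact.
split => //; exists C.
have := weak_derivative_unique cf fw fg; move: gC.
apply: filterS2; first exact: (ae_filter_ringOfSetsType (@lebesgue_measure R)).
by move=> x gC wg xab; rewrite wg// gC.
Qed.

Lemma integrableM_ae_bounded (R : realType) (D : set R) (k g : R -> R) (C : R) :
  measurable D -> (@lebesgue_measure R).-integrable D (EFin \o k) ->
  measurable_fun D g ->
  {ae @lebesgue_measure R, forall x, D x -> `|g x| <= C} ->
  (@lebesgue_measure R).-integrable D (EFin \o (fun x => k x * g x)).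
Proof.
move=> mD ik mg gC.
have mk : measurable_fun D k.
  by apply/measurable_EFinP; exact: measurable_int ik.
have mkg : measurable_fun D (fun x => k x * g x) by exact: measurable_funM.
apply/integrableP; split; first exact/measurable_EFinP.
apply: (@le_lt_trans _ _ (\int[@lebesgue_measure R]_(x in D)
    (`|C|%:E * `|(k x)%:E|))%E).
  apply: ae_ge0_le_integral => //.
  - by apply: measurableT_comp => //; exact/measurable_EFinP.
  - apply: measurable_funeM; apply: measurableT_comp => //.
    exact/measurable_EFinP.
  - move: gC; apply: filterS.
      exact: (ae_filter_ringOfSetsType (@lebesgue_measure R)).
    move=> x gC Dx /=; rewrite -EFinM lee_fin normrM mulrC ler_wpM2r//.
    by rewrite (le_trans (gC Dx))// ler_norm.
rewrite ge0_integralZl//; last first.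
  by apply: measurableT_comp => //; exact/measurable_EFinP.
rewrite lte_mul_pinfty//.
by have /integrableP[] := ik.
Qed.

(** * The singular kernel and the Gamma function *)

(** Monotone convergence along an exhaustion by compact intervals: on each of
    them the integral is at most the increment of K.  A majorant k is allowed
    because the Gamma integrand has no elementary primitive. *)
Lemma integrable_bounded_primitive (R : realType) (p q : nat -> R)
    (h k K : R -> R) (B : R) :
  (forall n, p n < q n) -> (forall n, p n.+1 <= p n) ->
  (forall n, q n <= q n.+1) ->
  let D := \bigcup_n `[p n, q n]%classic in
  (forall x, D x -> {for x, continuous h}) ->
  (forall x, D x -> {for x, continuous k}) ->
  (forall x, D x -> is_derive x 1 K (k x)) ->
  (forall x, D x -> 0 <= h x <= k x) ->
  (forall x, D x -> `|K x| <= B) ->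
  (@lebesgue_measure R).-integrable D (EFin \o h).
Proof.
move=> pq dp iq D ch ck dK hk KB.
have FD n x : `[p n, q n]%classic x -> D x by exists n.
have wc (f : R -> R) n : (forall x, D x -> {for x, continuous f}) ->
    {within `[p n, q n], continuous f}.
  move=> cf; apply: continuous_in_subspaceT => x; rewrite inE => xF.
  exact/cf/FD/xF.
have mh n : measurable_fun `[p n, q n] h.
  by apply: subspace_continuous_measurable_fun => //; exact: wc.
have mk n : measurable_fun `[p n, q n] k.
  by apply: subspace_continuous_measurable_fun => //; exact: wc.
have mD : measurable D by exact: bigcup_measurable.
have mhD : measurable_fun D h by apply/measurable_fun_bigcup.
have Ih n : (\int[@lebesgue_measure R]_(x in `[p n, q n]) (h x)%:E <= (B + B)%:E)%E.
  apply: (@le_trans _ _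
    (\int[@lebesgue_measure R]_(x in `[p n, q n]) (k x)%:E)%E).
    apply: ge0_le_integral => //.
    - by move=> x xF; have /andP[] := hk _ (FD _ _ xF).
    - by apply/measurable_EFinP; exact: mh.
    - by apply/measurable_EFinP; exact: mk.
    - by move=> x xF; have /andP[_] := hk _ (FD _ _ xF); rewrite lee_fin.
  have cK x : D x -> {for x, continuous K}.
    move=> Dx; apply/differentiable_continuous/derivable1_diffP.
    by have [] := dK _ Dx.
  have Dp : D (p n) by exists n => //; rewrite /= in_itv/= lexx ltW.
  have Dq : D (q n) by exists n => //; rewrite /= in_itv/= lexx andbT ltW.
  rewrite (@continuous_FTC2 _ k K)//; last 3 first.
  - exact: wc.
  - split.
    + move=> x /subset_itv_oo_cc xF.
      by have [] := dK x (FD _ _ xF).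
    + by apply: cvg_at_right_filter; exact: cK.
    + by apply: cvg_at_left_filter; exact: cK.
  - move=> x /subset_itv_oo_cc xF.
    by rewrite derive1E; have [_ ->] := dK x (FD _ _ xF).
  rewrite -EFinB lee_fin; have := KB _ Dp; have := KB _ Dq.
  rewrite !ler_norml; move: (K (p n)) (K (q n)) => x y /andP[? ?] /andP[? ?].
  by lra.
apply/integrableP; split; first by apply/measurable_EFinP.
have -> : (\int[@lebesgue_measure R]_(x in D) `|(EFin \o h) x| =
    \int[@lebesgue_measure R]_(x in D) (h x)%:E)%E.
  apply: eq_integral => x; rewrite inE => Dx /=; rewrite ger0_norm//.
  by have /andP[] := hk _ Dx.
apply: (@le_lt_trans _ _ (B + B)%:E); last exact: ltry.
have ndF : nondecreasing_seq (fun n => `[p n, q n]%classic).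
  apply/nondecreasing_seqP => n; rewrite subsetEset => x /=.
  rewrite !in_itv/= => /andP[px xq].
  by rewrite (le_trans (dp n) px) (le_trans xq (iq n)).
have cv : (\int[@lebesgue_measure R]_(x in `[p n, q n]) (EFin \o h) x)%E
    @[n --> \oo] --> (\int[@lebesgue_measure R]_(x in D) (EFin \o h) x)%E.
  apply: ge0_nondecreasing_set_cvg_integral => //.
  - by move=> n; apply/measurable_EFinP; exact: mh.
  - by move=> n x xF; have /andP[] := hk _ (FD _ _ xF).
rewrite -(cvg_lim _ cv)//; apply: lime_le; first by apply/cvg_ex; eexists; exact: cv.
exact: nearW.
Qed.

Lemma continuous_powR (R : realType) (r x : R) : 0 < x ->
  {for x, continuous (fun y : R => y `^ r)}.
Proof.
move=> x0; apply/differentiable_continuous/derivable1_diffP.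
by have [] := is_derive1_powR r x0.
Qed.

Lemma integrable_singular_kernel (R : realType) (alpha a t : R) :
  alpha < 1 -> a < t ->
  (@lebesgue_measure R).-integrable `]a, t[
    (EFin \o (fun s => (t - s) `^ (- alpha))).
Proof.
move=> al1 at_; have al0 : 0 < 1 - alpha by rewrite subr_gt0.
pose q n := t - (t - a) / n.+2%:R.
have dk x : x < t -> is_derive x 1
    (fun s => - ((1 - alpha)^-1 * (t - s) `^ (1 - alpha))) ((t - x) `^ (- alpha)).
  move=> xt; have tx : 0 < t - x by rewrite subr_gt0.
  have tE y : -1 * y + t = t - y by rewrite mulN1r addrC.
  have d1 : is_derive (-1 * x + t) 1 (fun y : R => y `^ (1 - alpha))
      ((1 - alpha) * (t - x) `^ (1 - alpha - 1)).
    by rewrite tE; exact: is_derive1_powR.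
  have d2 := is_derive1_affine d1.
  have d3 := is_deriveN (is_deriveZ (1 - alpha)^-1 d2).
  apply: (@is_derive_eq _ _ _ (fun s => - ((1 - alpha)^-1 * (t - s) `^ (1 - alpha)))).
    move: d3; congr is_derive; apply/funext => y /=.
    by rewrite -tE.
  rewrite /GRing.scale/= mulN1r mulrN opprK mulrA mulVf ?gt_eqF// mul1r.
  by rewrite addrAC subrr add0r.
have qt n : q n < t by rewrite /q ltrBlDr ltrDl divr_gt0// subr_gt0.
have DE : \bigcup_n `[a, q n]%classic = `[a, t[%classic.
  apply/seteqP; split => [x [n _] /=|x /=]; rewrite !in_itv/= => /andP[ax].
    by move=> xq; rewrite ax (le_lt_trans xq).
  move=> xt.
  near \oo => n; exists n => //=; rewrite in_itv/= ax /q/= lerBrDr -lerBrDl.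
  rewrite ler_pdivrMr// mulrC -ler_pdivrMr ?subr_gt0//.
  apply: (@le_trans _ _ n%:R); last by rewrite ler_nat ltnW.
  by near: n; exact: nbhs_infty_ger.
suff : (@lebesgue_measure R).-integrable `[a, t[
    (EFin \o (fun s => (t - s) `^ (- alpha))).
  by apply: integrableS => // x /=; rewrite !in_itv/= => /andP[/ltW -> ->].
rewrite -DE.
have tx x : (\bigcup_n `[a, q n]%classic) x -> a <= x /\ x < t.
  by rewrite DE /= in_itv/= => /andP[].
have ck x : (\bigcup_n `[a, q n]%classic) x ->
    {for x, continuous (fun s => (t - s) `^ (- alpha))}.
  move=> /tx[_ xt].
  have c1 : {for x, continuous (fun s => t - s)}.
    by apply: cvgB; [exact: cvg_cst|exact: cvg_id].
  apply: (continuous_comp c1 (g := fun y : R => y `^ (- alpha))).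
  by apply: continuous_powR; rewrite subr_gt0.
apply: (@integrable_bounded_primitive _ (fun=> a) q _
  (fun s => (t - s) `^ (- alpha))
  (fun s => - ((1 - alpha)^-1 * (t - s) `^ (1 - alpha)))
  ((1 - alpha)^-1 * (t - a) `^ (1 - alpha))) => //.
- move=> n; rewrite /q ltrBrDr -ltrBrDl ltr_pdivrMr//.
  by rewrite ltr_pMr ?subr_gt0// ltr1n.
- move=> n; rewrite /q lerB// ler_pM2l ?subr_gt0//.
  by rewrite lef_pV2 ?posrE// ler_nat.
- by move=> x /tx[_]; exact: dk.
- by move=> x _; rewrite powR_ge0 lexx.
- move=> x /tx[ax xt]; rewrite normrN ger0_norm; last first.
    by rewrite mulr_ge0 ?powR_ge0// invr_ge0 ltW.
  rewrite ler_pM2l ?invr_gt0//; apply: ge0_ler_powR; rewrite ?nnegrE ?subr_ge0.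
  + exact: ltW.
  + exact: ltW.
  + exact: ltW.
  + exact: lerB.
Unshelve. all: by end_near. Qed.

Section Gamma_gt0.
Context (R : realType).

Let pw_le (r x : R) : 0 <= r <= 1 -> 0 < x -> x `^ r <= 1 + x.
Proof.
move=> /andP[r0 r1] x0; have [x1|x1] := leP 1 x.
  apply: (@le_trans _ _ (x `^ 1)); first exact: ler_powR.
  by rewrite powRr1 ?(ltW x0)// lerDr.
apply: (@le_trans _ _ (x `^ 0)); last by rewrite powRr0 lerDl ltW.
by apply: ger_powR => //; rewrite x0 ltW.
Qed.

(** The derivative of x ^ z e ^ (- x) is the Gamma integrand up to the factor z
    and the term - x ^ z e ^ (- x).  As x ^ z <= 1 + x, the derivative
    (1 + x) e ^ (- x) of - (2 + x) e ^ (- x) compensates that term. *)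
Let Gamma_integrand_primitive (z x : R) : 0 < z -> 0 < x ->
  is_derive x 1 (fun y : R => z^-1 * (y `^ z * expR (- y) - (2 + y) * expR (- y)))
   (z^-1 * (z * (x `^ (z - 1) * expR (- x)) + (1 + x - x `^ z) * expR (- x))).
Proof.
move=> z0 x0.
have d1 : is_derive x 1 (fun y : R => y `^ z) (z * x `^ (z - 1)).
  exact: is_derive1_powR.
have d2 : is_derive x 1 (fun y : R => expR (- y)) (- expR (- x)).
  have dN : is_derive x 1 (fun y : R => - y) (- 1) by exact: is_deriveNid.
  have := @is_derive1_comp R expR (fun y : R => - y) x _ _ _ dN.
  by move=> /(_ _ (is_derive_expR _)) d; apply: is_derive_eq d _; rewrite mulrN1.
have d3 : is_derive x 1 (fun y : R => 2 + y) 1.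
  have d := is_deriveD (is_derive_cst (2 : R) x (1 : R)) (is_derive_id x (1 : R)).
  by apply: is_derive_eq d _; rewrite add0r.
have d := is_deriveZ z^-1 (is_deriveB (is_deriveM d1 d2) (is_deriveM d3 d2)).
apply: is_derive_eq d _; rewrite /GRing.scale/=.
by congr (_ * _); ring.
Qed.

(** This contains the finiteness of the integral, since the real-valued
    integral of a function of infinite integral is 0. *)
Lemma Gamma_gt0 (z : R) : 0 < z -> z <= 1 -> 0 < Gamma z.
Proof.
move=> z0 z1.
pose h (x : R) := (x `^ (z - 1)) * expR (- x).
pose p n : R := (n.+2%:R)^-1.
pose q n : R := n.+2%:R.
have DE : \bigcup_n `[p n, q n]%classic = `]0, +oo[%classic :> set R.
  apply/seteqP; split => [x [n _] /=|x /=]; rewrite !in_itv/= ?andbT.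
    by move=> /andP[px _]; apply: lt_le_trans px; rewrite invr_gt0.
  move=> x0; near \oo => n; exists n => //=; rewrite in_itv/=; apply/andP; split.
    rewrite -[x]invrK lef_pV2 ?posrE ?invr_gt0//.
    apply: (@le_trans _ _ n%:R); last by rewrite ler_nat ltnW.
    by near: n; exact: nbhs_infty_ger.
  apply: (@le_trans _ _ n%:R); last by rewrite ler_nat ltnW.
  by near: n; exact: nbhs_infty_ger.
have Dgt0 x : (\bigcup_n `[p n, q n]%classic) x -> 0 < x.
  by rewrite DE /= in_itv/= andbT.
have ce : continuous (fun x : R => expR (- x)).
  move=> x; apply: (@continuous_comp _ _ _ -%R expR); first exact: opp_continuous.
  exact: continuous_expR.
have ih : (@lebesgue_measure R).-integrable `]0, +oo[ (EFin \o h).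
  rewrite -DE.
  apply: (@integrable_bounded_primitive _ p q h
    (fun x => z^-1 * (z * (x `^ (z - 1) * expR (- x)) +
      (1 + x - x `^ z) * expR (- x)))
    (fun y : R => z^-1 * (y `^ z * expR (- y) - (2 + y) * expR (- y)))
    (z^-1 * 3)).
  - move=> n; apply: (@lt_trans _ _ 1); last by rewrite ltr1n.
    by rewrite invf_lt1// ltr1n.
  - by move=> n; rewrite lef_pV2 ?posrE// ler_nat.
  - by move=> n; rewrite ler_nat.
  - move=> x /Dgt0 x0; apply: cvgM; last exact: ce.
    exact: continuous_powR.
  - move=> x /Dgt0 x0; apply: cvgMr; apply: cvgD.
      by apply: cvgMr; apply: cvgM; [exact: continuous_powR|exact: ce].
    apply: cvgM; last exact: ce.
    apply: cvgB; last exact: continuous_powR.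
    by apply: cvgD; [exact: cvg_cst|exact: cvg_id].
  - by move=> x /Dgt0 x0; exact: Gamma_integrand_primitive.
  - move=> x /Dgt0 x0; rewrite /h mulr_ge0 ?powR_ge0 ?expR_ge0//=.
    rewrite [leRHS]mulrDr mulKf ?gt_eqF// lerDl.
    rewrite mulr_ge0 ?invr_ge0 ?(ltW z0)// mulr_ge0 ?expR_ge0// subr_ge0.
    by apply: pw_le => //; rewrite (ltW z0).
  - move=> x /Dgt0 x0; rewrite normrM ger0_norm ?invr_ge0 ?(ltW z0)//.
    rewrite ler_pM2l ?invr_gt0// -mulrBl normrM [`|expR _|]gtr0_norm ?expR_gt0//.
    rewrite expRN ler_pdivrMr ?expR_gt0//.
    have := pw_le _ x0; move=> /(_ z); rewrite (ltW z0) z1 => /(_ isT).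
    have := powR_ge0 x z; have := expR_ge1Dx x.
    move: (expR x) (x `^ z) => e w ? ? ?.
    by rewrite ler_norml; apply/andP; split; lra.
have h0 (x : R) : 0 < x -> 0 < h x by move=> x0; rewrite mulr_gt0 ?powR_gt0 ?expR_gt0.
have hc x : 1 <= x <= 2 -> 2^-1 * expR (-2) <= h x.
  move=> /andP[x1 x2].
  apply: ler_pM; rewrite ?expR_ge0 ?invr_ge0 ?ler_expR ?lerN2//.
  apply: (@le_trans _ _ (x `^ (-1))).
    rewrite powR_inv1; last lra.
    by rewrite lef_pV2 ?posrE//; lra.
  by apply: ler_powR => //; lra.
apply: (@lt_le_trans _ _ (2^-1 * expR (-2))).
  by rewrite mulr_gt0 ?invr_gt0 ?expR_gt0.
have mh := measurable_int _ ih.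
rewrite /Gamma -[leLHS]/(fine (2^-1 * expR (-2))%:E) /Rintegral fine_le//.
  exact: integrable_fin_num.
apply: (@le_trans _ _ (\int[@lebesgue_measure R]_(x in `[1%R, 2%R]) (h x)%:E)%E).
  have := @integral_cst _ _ _ (@lebesgue_measure R) `[1%R, 2%R]%classic
    (measurable_itv _) (2^-1 * expR (-2))%:E.
  rewrite /= lebesgue_measure_itv/= lte_fin ltr1n -EFinB.
  have -> : 2 - 1 = 1 :> R by lra.
  rewrite mule1 => <-; apply: ge0_le_integral => //.
  - apply: measurable_funS mh => // x; rewrite /= !in_itv/= andbT => /andP[x1 _].
    exact: lt_le_trans x1.
apply: ge0_subset_integral => //.
- by move=> x; rewrite /= in_itv/= andbT lee_fin => /h0 /ltW.
- move=> x; rewrite /= !in_itv/= andbT => /andP[x1 _].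
  exact: lt_le_trans x1.
Unshelve. all: by end_near. Qed.

End Gamma_gt0.

(** * Integrals against nondecreasing weights *)

(** For y >= 0, the minimum of N and the integer part of y, as a sum of
    indicators of superlevel sets. *)
Definition level_count (R : realType) (N : nat) (y : R) : R :=
  \sum_(i < N) (i.+1%:R <= y)%R%:R.

Lemma level_count_bounds (R : realType) (N : nat) (y : R) : 0 <= y ->
  0 <= level_count N y <= y /\ (y <= N%:R -> y - 1 <= level_count N y).
Proof.
move=> y0; rewrite /level_count.
have full m : m%:R <= y -> \sum_(i < m) (i.+1%:R <= y)%R%:R = m%:R :> R.
  move=> my; under eq_bigr => i _.
    rewrite (le_trans _ my) ?ler_nat//; over.
  by rewrite sumr_const card_ord.
elim: N => [|N [/andP[IH0 IH1] IH2]].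
  by rewrite big_ord0 lexx y0; split => // yN; rewrite mulr0n in yN; lra.
have [Ny|yN] := leP N.+1%:R y.
  by rewrite full// Ny ler0n; split => // yN; rewrite lerBlDr (le_trans yN)// lerDl.
have -> : \sum_(i < N.+1) (i.+1%:R <= y)%R%:R =
    \sum_(i < N) (i.+1%:R <= y)%R%:R :> R.
  have : (N.+1%:R <= y) = false by rewrite leNgt yN.
  by rewrite big_ord_recr/= => ->; rewrite addr0.
rewrite IH0 IH1; split => // _.
have [yN'|Ny] := leP y N%:R; first exact: IH2.
by rewrite (full _ (ltW Ny)) lerBlDr natr1 ltW.
Qed.

(** An upper set of the interval is a final segment, with or without its left
    end point. *)
Lemma upper_set_integral_ge0 (R : realType) (p q : R) (A : set R) (h : R -> R) :
  p < q -> (forall s s', A s -> s <= s' -> s' < q -> A s') ->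
  A `<=` `]p, q[ ->
  (@lebesgue_measure R).-integrable `]p, q[ (EFin \o h) ->
  (forall r, p <= r < q -> 0 <= \int[@lebesgue_measure R]_(s in `]r, q[) h s) ->
  0 <= \int[@lebesgue_measure R]_(s in A) h s.
Proof.
move=> pq upA Apq ih h0.
have [->|/set0P A0] := eqVneq A set0; first by rewrite Rintegral_set0.
have lbA : has_lbound A.
  by exists p => x /Apq /=; rewrite in_itv/= => /andP[/ltW].
have rA s : A s -> inf A <= s by move=> As; exact: ge_inf.
have Ar s : inf A < s -> s < q -> A s.
  by move=> /(inf_lt A0)[y Ay /ltW ys] sq; exact: (upA y).
have pr : p <= inf A.
  by apply: lb_le_inf => // x /Apq /=; rewrite in_itv/= => /andP[/ltW].
have rq : inf A < q.
  have [x Ax] := A0; apply: le_lt_trans (rA _ Ax) _.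
  by have /= := Apq _ Ax; rewrite in_itv/= => /andP[].
have ihr : (@lebesgue_measure R).-integrable `]inf A, q[ (EFin \o h).
  apply: integrableS ih => // x /=; rewrite !in_itv/= => /andP[rx ->].
  by rewrite (le_lt_trans pr rx).
have Aq s : A s -> s < q.
  by move=> /Apq /=; rewrite in_itv/= => /andP[].
have [rinA|rnA] := pselect (A (inf A)).
  have -> : A = `[inf A, q[%classic.
    apply/seteqP; split => [s As|s] /=; rewrite in_itv/=.
      by rewrite rA//= Aq.
    by rewrite le_eqVlt => /andP[/predU1P[<-//|rs sq]]; exact: Ar.
  by rewrite -Rintegral_itv_obnd_cbnd// h0// pr.
have -> : A = `]inf A, q[%classic.
  apply/seteqP; split => [s As|s] /=; rewrite in_itv/=.
    rewrite Aq// andbT lt_neqAle rA// andbT.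
    by apply: contra_notN rnA => /eqP ->.
  by move=> /andP[rs sq]; exact: Ar.
by rewrite h0// pr.
Qed.

(** A nondecreasing weight is a positive mixture of indicators of intervals
    ending at the right end point; on each of them the integral is
    nonnegative.  As the weight may be unbounded at the right end point, the
    mixtures are passed to the limit by domination. *)
Lemma nondecreasing_weight_ge0 (R : realType) (p q : R) (k h : R -> R) :
  p < q -> measurable_fun `]p, q[ k ->
  (forall s, p < s < q -> 0 <= k s) ->
  (forall s s', p < s -> s <= s' -> s' < q -> k s <= k s') ->
  (@lebesgue_measure R).-integrable `]p, q[ (EFin \o h) ->
  (@lebesgue_measure R).-integrable `]p, q[ (EFin \o (fun s => k s * h s)) ->
  (forall r, p <= r < q -> 0 <= \int[@lebesgue_measure R]_(s in `]r, q[) h s) ->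
  0 <= \int[@lebesgue_measure R]_(s in `]p, q[) (k s * h s).
Proof.
move=> pq mk k0 kincr ih ikh h0.
have mh : measurable_fun `]p, q[ h.
  by apply/measurable_EFinP; exact: measurable_int ih.
have mA c : measurable (`]p, q[ `&` [set s | c <= k s]).
  rewrite (_ : [set s | _] = k @^-1` `[c, +oo[%classic); last first.
    by apply/seteqP; split => s /=; rewrite in_itv/= andbT.
  exact: mk.
have mI c : measurable_fun `]p, q[ (fun s => (c <= k s)%R%:R : R).
  have : measurable_fun `]p, q[ (\1_(`]p, q[ `&` [set s | c <= k s]) : R -> R).
    exact: measurable_indic.
  apply: eq_measurable_fun => s; rewrite inE => spq.
  rewrite indicE; congr (_%:R); congr nat_of_bool.
  by apply/idP/idP => [|cs]; rewrite inE => //= -[].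
have iI c : (@lebesgue_measure R).-integrable `]p, q[
    (EFin \o (fun s => (c <= k s)%R%:R * h s)).
  apply: le_integrable ih => //.
    by apply/measurable_EFinP; apply: measurable_funM => //; exact: mI.
  move=> s _ /=; rewrite lee_fin normrM.
  by case: (c <= k s); rewrite ?normr1 ?mul1r// normr0 mul0r.
have I0 c : 0 <= \int[@lebesgue_measure R]_(s in `]p, q[) ((c <= k s)%R%:R * h s).
  have -> : \int[@lebesgue_measure R]_(s in `]p, q[) ((c <= k s)%R%:R * h s) =
      \int[@lebesgue_measure R]_(s in `]p, q[ `&` [set s | c <= k s]) h s.
    rewrite Rintegral_mkcondr; apply: eq_Rintegral => s _.
    rewrite patchE; have [cs|cs] := boolP (c <= k s).
      by rewrite mem_set// mul1r.
    by rewrite memNset ?mul0r//; exact/negP.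
  apply: (upper_set_integral_ge0 pq) => //.
  move=> s s' [/= + cs] ss' s'q; rewrite in_itv/= => /andP[ps _].
  rewrite in_itv/= (lt_le_trans ps ss') s'q; split => //.
  exact/(le_trans cs)/kincr.
(* At stage n the levels are the multiples of 1 / n.+1 up to n.+1, which
   takes n.+1 ^ 2 of them. *)
pose c n i : R := i.+1%:R / n.+1%:R.
pose S n N s : R := \sum_(i < N) (c n i <= k s)%R%:R.
have S1 n N : (@lebesgue_measure R).-integrable `]p, q[
    (EFin \o (fun s => S n N s * h s)) /\
    0 <= \int[@lebesgue_measure R]_(s in `]p, q[) (S n N s * h s).
  elim: N => [|N [iN N0]].
    have E : (fun s => S n 0 s * h s) = cst 0.
      by apply/funext => s; rewrite /S big_ord0 mul0r.
    rewrite E; split; first exact: integrable0.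
    by apply: Rintegral_ge0.
  have E : (fun s => S n N.+1 s * h s) =
      (fun s => S n N s * h s + (c n N <= k s)%R%:R * h s).
    by apply/funext => s; rewrite /S big_ord_recr/= mulrDl.
  rewrite E; split; last by rewrite RintegralD// addr_ge0.
  exact: (integrableD _ iN (iI (c n N))).
pose kn n s := S n (n.+1 ^ 2)%N s / n.+1%:R.
have n0 n : (0 : R) < n.+1%:R by [].
have SE n s : S n (n.+1 ^ 2)%N s = level_count (n.+1 ^ 2)%N (k s * n.+1%:R).
  by apply: eq_bigr => i _; rewrite /c ler_pdivrMr.
have kn_bound n s : p < s < q -> 0 <= kn n s <= k s.
  move=> spq; have ks := k0 _ spq.
  have [/andP[l0 l1] _] := level_count_bounds (n.+1 ^ 2)%N (mulr_ge0 ks (ltW (n0 n))).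
  by rewrite /kn SE divr_ge0//= ler_pdivrMr.
have mS n N : measurable_fun `]p, q[ (S n N).
  apply: measurable_sum => i; exact: mI.
have cvk : (\int[@lebesgue_measure R]_(s in `]p, q[) (kn n s * h s)) @[n --> \oo]
    --> \int[@lebesgue_measure R]_(s in `]p, q[) (k s * h s).
  apply: (@dominated_Rintegral_cvg _ _ _ _ (fun s => `|k s * h s|)) => //.
  - move=> n; apply: measurable_funM => //.
    by apply: measurable_funM => //; exact: mS.
  - exact: measurable_funM.
  - move=> s; rewrite /= in_itv/= => spq; apply: cvgMl.
    apply/cvgrPdist_le => e e0; near=> n.
    have ks := k0 _ spq.
    have [_ L] := level_count_bounds (n.+1 ^ 2)%N (mulr_ge0 ks (ltW (n0 n))).
    have /andP[_ kns] := kn_bound n _ spq.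
    rewrite ger0_norm ?subr_ge0// lerBlDr -lerBlDl.
    rewrite /kn SE ler_pdivlMr//; apply: le_trans (L _); last first.
      rewrite natrX expr2 ler_pM2r//.
      apply: (@le_trans _ _ n%:R); last by rewrite ler_nat.
      by near: n; exact: nbhs_infty_ger.
    rewrite mulrBl lerB// -ler_pdivrMl//.
    rewrite mulr1.
    apply: (@le_trans _ _ n%:R); last by rewrite ler_nat.
    by near: n; exact: nbhs_infty_ger.
  - exact: integrable_norm.
  - move=> n s; rewrite /= in_itv/= => spq.
    have /andP[kn0 kns] := kn_bound n _ spq.
    by rewrite /= normrM [leRHS]normrM ler_wpM2r// (ger0_norm kn0) (ger0_norm (k0 _ spq)).
apply: (cvgr_to_ge cvk); apply: nearW => n.
have [iS S0] := S1 n (n.+1 ^ 2)%N.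
have -> : \int[@lebesgue_measure R]_(s in `]p, q[) (kn n s * h s) =
    n.+1%:R^-1 *
    \int[@lebesgue_measure R]_(s in `]p, q[) (S n (n.+1 ^ 2)%N s * h s).
  rewrite -RintegralZl//; apply: eq_Rintegral => s _.
  by rewrite /kn mulrA [_^-1 * _]mulrC.
by rewrite mulr_ge0.
Unshelve. all: by end_near. Qed.

(** * The Caputo derivative at a maximum *)

Section singular_weight.
Context (R : realType) (alpha t : R).
Local Notation mu := (@lebesgue_measure R).
Let k (s : R) := (t - s) `^ (- alpha).

Lemma kernel_nondecreasing (s s' : R) : 0 < alpha -> s <= s' -> s' < t ->
  k s <= k s'.
Proof.
move=> a0 ss' s't; rewrite /k !powRN.
have t0 : 0 < t - s' by rewrite subr_gt0.
have t1 : 0 < t - s by rewrite subr_gt0 (le_lt_trans ss').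
rewrite lef_pV2 ?posrE ?powR_gt0//.
apply: ge0_ler_powR; [exact: ltW|exact: ltW|exact: ltW|].
by rewrite lerD2l lerN2.
Qed.

Lemma measurable_kernel (a : R) : measurable_fun `]a, t[ k.
Proof.
apply: open_continuous_measurable_fun; first exact: interval_open.
move=> s; rewrite inE /= in_itv/= => /andP[_ st].
have c1 : {for s, continuous (fun s => t - s)}.
  by apply: cvgB; [exact: cvg_cst|exact: cvg_id].
apply: (continuous_comp c1 (g := fun y : R => y `^ (- alpha))).
by apply: continuous_powR; rewrite subr_gt0.
Qed.

(** Normalised indicator of the interval from x to y; it stands in for a point
    mass when integrals over final segments are compared. *)
Definition mass (x y s : R) : R := (y - x)^-1 * \1_`]x, y[ s.

Lemma mass_ge0 (x y s : R) : x < y -> 0 <= mass x y s.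
Proof. by move=> xy; rewrite /mass mulr_ge0 ?invr_ge0 ?subr_ge0 ?(ltW xy). Qed.

Lemma mass_out (x y s : R) : ~~ (x < s < y) -> mass x y s = 0.
Proof.
by move=> xsy; rewrite /mass indicE memNset ?mulr0//= in_itv/=; exact/negP.
Qed.

Lemma measurable_mass (D : set R) (x y : R) :
  measurable D -> measurable_fun D (mass x y).
Proof.
move=> mD; apply: measurable_funM; first exact: measurable_cst.
exact: measurable_indic.
Qed.

Lemma integrable_indic_itvS (D : set R) (x y : R) : measurable D ->
  mu.-integrable D (EFin \o \1_`]x, y[).
Proof.
move=> mD; apply: (@integrableS _ _ _ mu setT) => //.
exact: integrable_indic_itv.
Qed.

Lemma integrable_mass (D : set R) (x y : R) : measurable D ->
  mu.-integrable D (EFin \o mass x y).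
Proof. by move=> mD; exact: (integrableZl _ _ (integrable_indic_itvS x y mD)). Qed.

Lemma Rintegral_mass (r x y : R) : x < y ->
  [/\ \int[mu]_(s in `]r, t[) mass x y s <= 1,
      y <= r -> \int[mu]_(s in `]r, t[) mass x y s = 0 &
      r <= x -> y <= t -> \int[mu]_(s in `]r, t[) mass x y s = 1].
Proof.
move=> xy.
have xy0 : 0 < y - x by rewrite subr_gt0.
have E : \int[mu]_(s in `]r, t[) mass x y s =
    (y - x)^-1 * fine (mu (`]x, y[ `&` `]r, t[)).
  rewrite RintegralZl//; last exact: integrable_indic_itvS.
  by rewrite /Rintegral integral_indic.
have mxy : mu `]x, y[ = (y - x)%:E.
  by rewrite lebesgue_measure_itv/= lte_fin xy EFinB.
rewrite E; split.
- rewrite mulrC ler_pdivrMr// mul1r -lee_fin.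
  have le1 : (mu (`]x, y[ `&` `]r, t[) <= (y - x)%:E)%E.
    rewrite -mxy; apply: le_measure; rewrite ?inE//.
    exact: measurableI.
  rewrite fineK// ge0_fin_numE//; exact: le_lt_trans le1 (ltry _).
- move=> yr; have -> : `]x, y[%classic `&` `]r, t[ = set0 :> set R.
    apply/seteqP; split => // s [] /=; rewrite !in_itv/= => /andP[_ sy] /andP[rs _].
    by move: (lt_le_trans sy yr) => /(lt_trans rs); rewrite ltxx.
  by rewrite measure0/= mulr0.
- move=> rx yt; have -> : `]x, y[%classic `&` `]r, t[ = `]x, y[%classic :> set R.
    apply/seteqP; split => [s []//|s] /=; rewrite !in_itv/= => /andP[xs sy].
    by rewrite xs sy (le_lt_trans rx xs) (lt_le_trans sy yt).
  by rewrite mxy/= mulVf// gt_eqF.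
Qed.

Lemma kernel_mass_bounds (a x y : R) : 0 < alpha -> a <= x -> x < y -> y < t ->
  mu.-integrable `]a, t[ (EFin \o (fun s => k s * mass x y s)) /\
  k x <= \int[mu]_(s in `]a, t[) (k s * mass x y s) <= k y.
Proof.
move=> a0 ax xy yt.
have im : mu.-integrable `]a, t[ (EFin \o mass x y) by exact: integrable_mass.
have [_ _ /(_ ax (ltW yt)) m1] := Rintegral_mass a xy.
have kb s : k x * mass x y s <= k s * mass x y s <= k y * mass x y s.
  have [/andP[xs sy]|out] := boolP (x < s < y); last by rewrite mass_out ?mulr0 ?lexx.
  rewrite !ler_wpM2r ?mass_ge0//.
    by apply: kernel_nondecreasing => //; exact: ltW.
  by apply: kernel_nondecreasing => //; [exact: ltW|exact: lt_trans yt].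
have ic c : mu.-integrable `]a, t[ (EFin \o (fun s => c * mass x y s)).
  exact: (integrableZl _ c im).
have ikm : mu.-integrable `]a, t[ (EFin \o (fun s => k s * mass x y s)).
  apply: le_integrable (ic (k y)) => //.
    apply/measurable_EFinP; apply: measurable_funM; first exact: measurable_kernel.
    exact: measurable_mass.
  have km0 (r s : R) : 0 <= k r * mass x y s.
    by apply: mulr_ge0; [exact: powR_ge0|exact: mass_ge0].
  move=> s _ /=; rewrite lee_fin (ger0_norm (km0 _ _)) (ger0_norm (km0 _ _)).
  by have /andP[] := kb s.
split => //; apply/andP; split.
- rewrite -[leLHS]mulr1 -m1 -RintegralZl//.
  by apply: le_Rintegral => // s _; have /andP[] := kb s.
- rewrite -[leRHS]mulr1 -m1 -RintegralZl//.
  by apply: le_Rintegral => // s _; have /andP[] := kb s.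
Qed.

(** The difference of h and m times the mass has nonnegative integrals over
    all final segments, and the kernel is a nondecreasing weight. *)
Lemma kernel_compare (a x y m : R) (h : R -> R) :
  0 < alpha -> a <= x -> x < y -> y < t ->
  mu.-integrable `]a, t[ (EFin \o h) ->
  mu.-integrable `]a, t[ (EFin \o (fun s => k s * h s)) ->
  (forall r, a <= r < t -> m * \int[mu]_(s in `]r, t[) mass x y s <=
     \int[mu]_(s in `]r, t[) h s) ->
  m * \int[mu]_(s in `]a, t[) (k s * mass x y s) <=
    \int[mu]_(s in `]a, t[) (k s * h s).
Proof.
move=> a0 ax xy yt ih ikh hm.
have at_ : a < t by exact: le_lt_trans ax (lt_trans xy yt).
have [ikm _] := kernel_mass_bounds a0 ax xy yt.
have im D : measurable D -> mu.-integrable D (EFin \o (fun s => m * mass x y s)).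
  by move=> mD; exact: (integrableZl _ m (integrable_mass _ _ mD)).
have imk : mu.-integrable `]a, t[ (EFin \o (fun s => m * (k s * mass x y s))).
  exact: (integrableZl _ m ikm).
have E : (fun s => k s * (h s - m * mass x y s)) =
    (fun s => k s * h s - m * (k s * mass x y s)).
  by apply/funext => s; rewrite mulrBr [k s * (m * _)]mulrCA.
have : 0 <= \int[mu]_(s in `]a, t[) (k s * (h s - m * mass x y s)).
  apply: nondecreasing_weight_ge0 => //.
  - exact: measurable_kernel.
  - by move=> s _; exact: powR_ge0.
  - by move=> s s' _ ss' s't; exact: kernel_nondecreasing.
  - exact: (integrableB _ ih (im _ _)).
  - rewrite -/k E.
    exact: (integrableB _ ikh imk).
  - move=> r /andP[ar rt].
    have ihr : mu.-integrable `]r, t[ (EFin \o h).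
      by apply: integrableS ih => // s /=; rewrite !in_itv/= => /andP[/(le_lt_trans ar) -> ->].
    rewrite RintegralB//; last exact: im.
    rewrite RintegralZl//; last exact: integrable_mass.
    by rewrite subr_ge0 hm// ar.
rewrite E.
by rewrite RintegralB// RintegralZl// subr_ge0.
Qed.

End singular_weight.

(** What is used of the chosen weak derivative: its primitive is the function,
    and it can be integrated against the singular kernel. *)
Lemma W1infty_kernel (R : realType) (alpha eps t : R) (f : R -> R) :
  alpha < 1 -> eps < t ->
  {within `[eps, t], continuous f} -> W1infty eps t f ->
  let g := weak_derivative eps t f in
  [/\ (@lebesgue_measure R).-integrable `]eps, t[ (EFin \o g),
      (@lebesgue_measure R).-integrable `]eps, t[
        (EFin \o (fun s => (t - s) `^ (- alpha) * g s)) &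
      forall r, eps <= r < t ->
        \int[@lebesgue_measure R]_(s in `]r, t[) g s = f t - f r].
Proof.
move=> al1 et cf fW g.
have [[lg fg] [C gC]] := W1infty_weak_derivative cf fW.
have mg : measurable_fun `]eps, t[ g by have [] := lg.
have ik : (@lebesgue_measure R).-integrable `]eps, t[
    (EFin \o (fun s => (t - s) `^ (- alpha))) by exact: integrable_singular_kernel.
have i1 : (@lebesgue_measure R).-integrable `]eps, t[ (EFin \o (fun=> 1 : R)).
  by apply: integrable_within_oo; apply: continuous_subspaceT; exact: cst_continuous.
have ig : (@lebesgue_measure R).-integrable `]eps, t[ (EFin \o g).
  have := integrableM_ae_bounded (measurable_itv _) i1 mg gC.
  by apply: eq_integrable => // s _; rewrite /= mul1r.
split => //; first exact: (integrableM_ae_bounded _ ik mg gC).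
move=> r /andP[er rt]; apply: weak_FTC => //.
- apply: continuous_subspaceW cf => s /=; rewrite !in_itv/= => /andP[rs ->].
  by rewrite (le_trans er).
- apply: integrableS ig => // s /=; rewrite !in_itv/= => /andP[rs ->].
  by rewrite (le_lt_trans er).
- exact: weak_derivative_sub fg.
Qed.

Section caputo_bound.
Context (R : realType) (alpha t : R) (f : R -> R).
Local Notation mu := (@lebesgue_measure R).
Let k (s : R) := (t - s) `^ (- alpha).
Let I (eps : R) := \int[mu]_(s in `]eps, t[) (k s * weak_derivative eps t f s).

(** The two truncated integrals may use different weak derivatives of f, but
    over final segments that start after eps' these have the same integral.
    Only the oscillation of f before eps' is left, and it is dominated by a
    mass located after eps', away from the singularity at t. *)
Lemma truncated_caputo_diff (eps eps' x y w : R) :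
  0 < alpha -> alpha < 1 -> {within `[0, t], continuous f} ->
  (forall e, 0 < e < t -> W1infty e t f) ->
  0 < eps -> eps < eps' -> eps' <= x -> x < y -> y < t -> 0 <= w ->
  (forall r, eps <= r <= eps' -> `|f eps' - f r| <= w) ->
  `|I eps - I eps'| <= w * (t - y) `^ (- alpha).
Proof.
move=> al0 al1 cf fW e0 ee' ex xy yt w0 fw.
have e't : eps' < t by exact: le_lt_trans ex (lt_trans xy yt).
have et : eps < t by exact: lt_trans ee' e't.
have e'0 : 0 < eps' by exact: lt_trans ee'.
have cfe e : 0 < e -> {within `[e, t], continuous f}.
  move=> e00; apply: continuous_subspaceW cf => s /=; rewrite !in_itv/= => /andP[es ->].
  by rewrite (le_trans (ltW e00)).
have [ig ikg Hg] := W1infty_kernel al1 et (cfe _ e0) (fW eps ltac:(by rewrite e0 et)).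
have [ig' ikg' Hg'] := W1infty_kernel al1 e't (cfe _ e'0) (fW eps' ltac:(by rewrite e'0 e't)).
set g := weak_derivative eps t f in ig ikg Hg *.
set g' := weak_derivative eps' t f in ig' ikg' Hg' *.
(* Extending g' by zero brings both integrals to the same domain. *)
pose g1 := g' \_ `]eps', t[.
have sub r : `]r, t[ `&` `]eps', t[ = `]Num.max r eps', t[%classic :> set R.
  apply/seteqP; split => s /=; rewrite !in_itv/= gt_max.
    by move=> [/andP[-> _] /andP[-> ->]].
  by move=> /andP[/andP[-> ->] ->].
have Eg1 : (fun s => k s * g1 s) = (fun s => k s * g' s) \_ `]eps', t[.
  apply/funext => s; rewrite /g1 !patchE; case: ifP => // _; exact: mulr0.
have restr (j : R -> R) : mu.-integrable `]eps', t[ (EFin \o j) ->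
    mu.-integrable `]eps, t[ (EFin \o (j \_ `]eps', t[)).
  move=> ij; rewrite -restrict_EFin.
  apply: (@integrableS _ _ _ mu setT) => //.
  exact/(integrable_mkcond _ _).1.
have ig1 : mu.-integrable `]eps, t[ (EFin \o g1) by exact: restr.
have ikg1 : mu.-integrable `]eps, t[ (EFin \o (fun s => k s * g1 s)).
  by rewrite Eg1; exact: restr.
have I' : \int[mu]_(s in `]eps, t[) (k s * g1 s) = I eps'.
  rewrite Eg1 -Rintegral_mkcondr sub (_ : Num.max _ _ = eps')//.
  by rewrite max_r// ltW.
have Hh r : eps <= r < t -> \int[mu]_(s in `]r, t[) (g s - g1 s) =
    f (Num.max r eps') - f r.
  move=> /andP[er rt].
  have sr (j : R -> R) : mu.-integrable `]eps, t[ (EFin \o j) ->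
      mu.-integrable `]r, t[ (EFin \o j).
    apply: integrableS => // s /=; rewrite !in_itv/= => /andP[rs ->].
    by rewrite (le_lt_trans er).
  rewrite RintegralB//; [|exact: sr..].
  rewrite Hg ?er// -Rintegral_mkcondr sub Hg'; first by rewrite opprB addrC subrKA.
  by rewrite le_max lexx orbT gt_max rt.
have Hb r : eps <= r < t -> `|\int[mu]_(s in `]r, t[) (g s - g1 s)| <=
    w * \int[mu]_(s in `]r, t[) mass x y s.
  move=> ert; rewrite Hh//; move/andP : ert => [er rt].
  have [re|er'] := leP r eps'.
    have [_ _ ->] := Rintegral_mass t r xy; rewrite ?mulr1 ?fw ?er ?(ltW yt)//.
    exact: le_trans re ex.
  rewrite subrr normr0 mulr_ge0//; apply: Rintegral_ge0 => s _.
  exact: mass_ge0.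
have ih : mu.-integrable `]eps, t[ (EFin \o (fun s => g s - g1 s)).
  exact: (integrableB _ ig ig1).
have Ekh : (fun s => k s * (g s - g1 s)) = (fun s => k s * g s - k s * g1 s).
  by apply/funext => s; rewrite mulrBr.
have ikh : mu.-integrable `]eps, t[ (EFin \o (fun s => k s * (g s - g1 s))).
  by rewrite Ekh; exact: (integrableB _ ikg ikg1).
have -> : I eps - I eps' = \int[mu]_(s in `]eps, t[) (k s * (g s - g1 s)).
  by rewrite Ekh RintegralB// I'.
have ex' : eps <= x by exact: le_trans (ltW ee') ex.
have [ikm /andP[_ km]] := kernel_mass_bounds al0 ex' xy yt.
have wkm : w * \int[mu]_(s in `]eps, t[) (k s * mass x y s) <= w * k y.
  by rewrite ler_wpM2l.
rewrite ler_norml; apply/andP; split.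
- apply: (@le_trans _ _ (- w * \int[mu]_(s in `]eps, t[) (k s * mass x y s))).
    by rewrite mulNr lerN2.
  apply: kernel_compare => // r ert; have := Hb _ ert; rewrite ler_norml.
  by rewrite mulNr => /andP[].
- apply: le_trans wkm; rewrite -lerN2 -mulNr.
  have -> : - (\int[mu]_(s in `]eps, t[) (k s * (g s - g1 s))) =
      \int[mu]_(s in `]eps, t[) (k s * (- (g s - g1 s))).
    rewrite -mulN1r -RintegralZl//; apply: eq_Rintegral => s _.
    by rewrite mulN1r mulrN.
  apply: kernel_compare => //.
  + exact: (integrableN ih).
  + have -> : (fun s => k s * (- (g s - g1 s))) = (fun s => - (k s * (g s - g1 s))).
      by apply/funext => s; rewrite mulrN.
    exact: (integrableN ikh).
  + move=> r ert; have := Hb _ ert; rewrite ler_norml mulNr => /andP[_ H].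
    have -> : \int[mu]_(s in `]r, t[) (- (g s - g1 s)) =
        - (\int[mu]_(s in `]r, t[) (g s - g1 s)).
      rewrite -[RHS]mulN1r -RintegralZl//.
        by apply: eq_Rintegral => s _; rewrite mulN1r.
      move/andP : ert => [er rt].
      apply: integrableS ih => // s /=; rewrite !in_itv/= => /andP[rs ->].
      by rewrite (le_lt_trans er).
    by rewrite lerN2.
Qed.

Lemma is_cvg_truncated_caputo : 0 < t ->
  0 < alpha -> alpha < 1 -> {within `[0, t], continuous f} ->
  (forall e, 0 < e < t -> W1infty e t f) ->
  cvg (I eps @[eps --> 0^'+]).
Proof.
move=> t0 al0 al1 cf fW.
have [x [y [x0 xy yt]]] : exists x y, [/\ 0 < x, x < y & y < t].
  exists (t / 3), (t / 2); split; lra.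
pose C := (t - y) `^ (- alpha).
have C0 : 0 <= C by exact: powR_ge0.
apply/cauchy_cvgP/cauchy_exP => e e0.
pose w := e / (2 * (C + 1)).
have w0 : 0 < w by rewrite divr_gt0// mulr_gt0// ltr_wpDl.
have /continuous_within_itvP := cf => /(_ t0)[_ /cvgrPdist_le/(_ (w / 2))].
rewrite divr_gt0// => /(_ isT)[d /= d0 Hd _].
pose m := Num.min (d / 2) x.
have m0 : 0 < m by rewrite lt_min x0 andbT divr_gt0.
have md : m < d by rewrite gt_min; apply/orP; left; lra.
have mx : m <= x by rewrite ge_min lexx orbT.
exists (I m); near=> eps.
have eps0 : 0 < eps by near: eps; exact: nbhs_right_gt.
have epsm : eps < m by near: eps; exact: nbhs_right_lt.
rewrite /ball/= distrC.
apply: le_lt_trans (truncated_caputo_diff al0 al1 cf fW eps0 epsm mx xy yt (ltW w0) _) _.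
  move=> r /andP[er rm].
  have H s : 0 < s -> s <= m -> `|f 0 - f s| <= w / 2.
    move=> s0 sm; apply: Hd => //=.
    by rewrite sub0r normrN gtr0_norm// (le_lt_trans sm).
  have := H m m0 (lexx m); have := H r (lt_le_trans eps0 er) rm.
  move: (f 0) (f m) (f r) => a b c.
  by rewrite !ler_norml => /andP[? ?] /andP[? ?]; apply/andP; split; lra.
rewrite -/C /w mulrAC ltr_pdivrMr ?mulr_gt0 ?ltr_wpDl//.
by rewrite ltr_pM2l//; lra.
Unshelve. all: by end_near. Qed.

(** The derivative at a maximum only sees the increments towards it, which are
    all nonnegative, and those starting before y are at least m.  Hence f' may
    be replaced with a mass m placed between x and y, where the kernel is at
    least its value at x. *)
Lemma caputo_max_ge (m x y : R) :
  0 < t -> 0 < alpha < 1 -> {within `[0, t], continuous f} ->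
  (forall e, 0 < e < t -> W1infty e t f) ->
  0 <= m -> 0 < x -> x < y -> y < t ->
  (forall r, 0 <= r < t -> f r <= f t) ->
  (forall r, 0 <= r <= y -> f r <= f t - m) ->
  (Gamma (1 - alpha))^-1 * (m * (t - x) `^ (- alpha)) <= caputo alpha f t.
Proof.
move=> t0 /andP[al0 al1] cf fW m0 x0 xy yt fmax fm.
have G0 : 0 < Gamma (1 - alpha) by apply: Gamma_gt0; lra.
rewrite /caputo ler_pM2l ?invr_gt0//.
apply: limr_ge; first exact: is_cvg_truncated_caputo.
near=> eps.
have eps0 : 0 < eps by near: eps; exact: nbhs_right_gt.
have epsx : eps < x by near: eps; exact: nbhs_right_lt.
have et : eps < t by exact: lt_trans epsx (lt_trans xy yt).
have cfe : {within `[eps, t], continuous f}.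
  apply: continuous_subspaceW cf => s /=; rewrite !in_itv/= => /andP[es ->].
  by rewrite (le_trans (ltW eps0)).
have [ig ikg Hg] := W1infty_kernel al1 et cfe (fW eps ltac:(by rewrite eps0 et)).
have [ikm /andP[km _]] := kernel_mass_bounds al0 (ltW epsx) xy yt.
apply: (@le_trans _ _ (m * \int[mu]_(s in `]eps, t[) (k s * mass x y s))).
  by rewrite ler_wpM2l.
apply: kernel_compare => //; first exact: ltW.
move=> r /andP[er rt]; rewrite Hg ?er//.
have r0 : 0 <= r by exact: le_trans (ltW eps0) er.
have [m1 my _] := Rintegral_mass t r xy.
have [ry|yr] := leP r y.
  apply: (@le_trans _ _ (m * 1)); first by rewrite ler_wpM2l.
  by rewrite mulr1 lerBrDr -lerBrDl fm// r0.
by rewrite my ?mulr0 ?subr_ge0 ?fmax ?r0//; exact: ltW.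
Unshelve. all: by end_near. Qed.

End caputo_bound.

(** * The elliptic operator at a maximum *)

(** Cholesky factorisation, by induction through the Schur complement of the
    first diagonal entry. *)
Lemma posdef_factor (R : realType) (n : nat) (A : 'M[R]_n) :
  A^T = A -> posdef A -> exists W : 'M[R]_n, A = W *m W^T.
Proof.
elim: n A => [|n IH] A symA posA; first by exists 0; apply/matrixP => -[].
rewrite -[n.+1]/(1 + n)%N in A symA posA *.
set a := A 0 0.
have a0 : 0 < a.
  have := posA (delta_mx 0 0); rewrite -rowE trmx_delta -colE !mxE; apply.
  apply/eqP => /matrixP /(_ 0 0); rewrite !mxE/= => /eqP.
  by rewrite oner_eq0.
pose r := ursubmx A; pose B := drsubmx A.
have ulE : ulsubmx A = a%:M.
  by rewrite [LHS]mx11_scalar; congr (_%:M); rewrite !mxE; congr (A _ _); apply/val_inj.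
have dlE : dlsubmx A = r^T by rewrite /r -{1}symA -trmx_ursub.
have symB : B^T = B by rewrite /B -{2}symA trmx_drsub.
have AE : A = block_mx a%:M r r^T B by rewrite -ulE -dlE submxK.
pose S := B - a^-1 *: (r^T *m r).
have symS : S^T = S.
  by rewrite /S linearB/= linearZ/= trmx_mul trmxK symB.
have posS : posdef S.
  move=> v v0.
  (* This first coordinate minimises the quadratic form of A among the
     extensions of v; the minimum is the quadratic form of S. *)
  pose c := - a^-1 *: (v *m r^T).
  have := posA (row_mx c v); rewrite {1}AE.
  rewrite mul_row_block tr_row_mx mul_row_col.
  have -> : c *m a%:M + v *m r^T = 0.
    rewrite mul_mx_scalar /c scalerA mulrN divff ?gt_eqF// scaleN1r.
    by rewrite addrC subrr.
  rewrite mul0mx add0r.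
  have -> : c *m r + v *m B = v *m S.
    rewrite /S mulmxBr -scalemxAr mulmxA /c -scalemxAl scaleNr.
    by rewrite addrC.
  apply; apply: contra_neq v0 => rc0.
  by rewrite -(row_mxKr c v) rc0 linear0.
have [V SV] := IH S symS posS.
pose q := Num.sqrt a.
have q0 : q != 0 by rewrite gt_eqF// sqrtr_gt0.
have qq : q * q = a by rewrite -expr2 sqr_sqrtr// ltW.
exists (block_mx q%:M 0 (q^-1 *: r^T) V).
rewrite tr_block_mx mulmx_block !trmx0 !mulmx0 !mul0mx !addr0.
rewrite tr_scalar_mx -scalar_mxM qq [in LHS]AE.
rewrite linearZ/= trmxK mul_scalar_mx scalerA divff// scale1r.
rewrite mul_mx_scalar scalerA divff// scale1r.
rewrite -scalemxAl -scalemxAr scalerA -invfM qq -SV /S.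
by rewrite addrC subrK.
Qed.

(** The derivative along w is uniform over nearby base points.  This strong
    form is additive in w, which reduces it to coordinate directions. *)
Definition strict_derive (R : realType) (d : nat) (f : 'rV[R]_d -> R)
    (x w : 'rV[R]_d) (L : R) : Prop :=
  forall e : R, 0 < e -> exists2 r : R, 0 < r & forall (y : 'rV[R]_d) (h : R),
    `|y - x| < r -> `|h| < r -> `|f (y + h *: w) - f y - h * L| <= e * `|h|.

Lemma strict_derive0 (R : realType) (d : nat) (f : 'rV[R]_d -> R)
  (x : 'rV[R]_d) : strict_derive f x 0 0.
Proof.
move=> e e0; exists 1 => // y h _ _.
by rewrite scaler0 addr0 subrr mulr0 subrr normr0 mulr_ge0// ltW.
Qed.

Lemma strict_deriveD (R : realType) (d : nat) (f : 'rV[R]_d -> R)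
    (x w w' : 'rV[R]_d) (L L' : R) :
  strict_derive f x w L -> strict_derive f x w' L' ->
  strict_derive f x (w + w') (L + L').
Proof.
move=> fw fw' e e0.
have e20 : 0 < e / 2 by rewrite divr_gt0.
have [r r0 Hr] := fw _ e20; have [r' r'0 Hr'] := fw' _ e20.
pose m := Num.min (Num.min r r') (r' / (2 * (`|w| + 1))).
have w1 : 0 < 2 * (`|w| + 1) by rewrite mulr_gt0// ltr_wpDl.
have m0 : 0 < m by rewrite !lt_min r0 r'0 divr_gt0.
have mr : m <= r by rewrite !ge_min lexx.
have mr' : m <= r' by rewrite !ge_min lexx orbT.
have mw : m <= r' / (2 * (`|w| + 1)) by rewrite !ge_min lexx orbT.
exists (Num.min m (r' / 2)); first by rewrite lt_min m0 divr_gt0.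
move=> y h; rewrite lt_min => /andP[yx yx2]; rewrite lt_min => /andP[hm hm2].
have H1 := Hr y h (lt_le_trans yx mr) (lt_le_trans hm mr).
have H2 : `|f (y + h *: w + h *: w') - f (y + h *: w) - h * L'| <= e / 2 * `|h|.
  apply: Hr'; last exact: lt_le_trans hm mr'.
  rewrite addrAC (le_lt_trans (ler_normD _ _))// normrZ.
  have : `|h| * (2 * (`|w| + 1)) < r'.
    by rewrite -ltr_pdivlMr//; exact: lt_le_trans hm mw.
  have := normr_ge0 h; have := normr_ge0 w.
  move: (`|h|) (`|w|) (`|y - x|) yx2 => a b c; nra.
rewrite scalerDr addrA.
have -> : f (y + h *: w + h *: w') - f y - h * (L + L') =
  (f (y + h *: w + h *: w') - f (y + h *: w) - h * L') +
  (f (y + h *: w) - f y - h * L) by ring.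
rewrite (le_trans (ler_normD _ _))//.
by rewrite (le_trans (lerD H2 H1))// -mulrDl -splitr.
Qed.

Lemma strict_deriveZ (R : realType) (d : nat) (f : 'rV[R]_d -> R)
    (x w : 'rV[R]_d) (c L : R) :
  strict_derive f x w L -> strict_derive f x (c *: w) (c * L).
Proof.
move=> fw e e0.
have c1 : 0 < `|c| + 1 by rewrite ltr_wpDl.
have [r r0 Hr] := fw (e / (`|c| + 1)) ltac:(by rewrite divr_gt0).
exists (Num.min r (r / (`|c| + 1))); first by rewrite lt_min r0 divr_gt0.
move=> y h; rewrite !lt_min => /andP[yx _] /andP[_ hr].
rewrite scalerA mulrA; apply: le_trans (Hr y (h * c) yx _) _.
  rewrite normrM; move: hr; rewrite ltr_pdivlMr//; apply: le_lt_trans.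
  by rewrite ler_wpM2l// lerDl.
rewrite normrM mulrACA [_^-1 * _]mulrC ler_piMr//.
  by rewrite mulr_ge0// ltW.
by rewrite ler_pdivrMr// mul1r lerDl.
Qed.

Lemma is_derive_line (R : realType) (d : nat) (f : 'rV[R]_d -> R)
    (y w : 'rV[R]_d) (s : R) :
  derivable f (y + s *: w) w ->
  is_derive s 1 (fun s : R => f (y + s *: w)) ('D_w f (y + s *: w)).
Proof.
move=> df.
have E : (fun h : R => h^-1 *: (((fun s : R => f (y + s *: w)) \o shift s) (h *: 1)
      - f (y + s *: w))) =
    (fun h : R => h^-1 *: ((f \o shift (y + s *: w)) (h *: w) - f (y + s *: w))).
  apply/funext => h /=; congr (_ *: (f _ - _)).
  by rewrite [h *: 1]mulr1 scalerDl addrCA.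
by split; rewrite /derivable /derive E.
Qed.

(** By the mean value theorem an increment in a coordinate direction is a value
    of the partial derivative near x. *)
Lemma strict_derive_partial (R : realType) (d : nat) (f : 'rV[R]_d -> R)
    (x : 'rV[R]_d) (i : 'I_d) :
  (\forall y \near x, derivable f y (delta_mx 0 i)) ->
  {for x, continuous (partial i f)} ->
  strict_derive f x (delta_mx 0 i) (partial i f x).
Proof.
move=> df cf e e0.
move: cf => /cvgrPdist_le/(_ e e0) cf.
have /nbhs_ballP[r /= r0 Hr] : \forall y \near x,
    derivable f y (delta_mx 0 i) /\ `|partial i f x - partial i f y| <= e.
  by near=> y; split; near: y.
pose D : R := `|delta_mx 0 i : 'rV[R]_d| + 1.
have D0 : 0 < D by rewrite ltr_wpDl.
exists (r / (2 * D)); first by rewrite divr_gt0// mulr_gt0.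
move=> y h yx hr.
pose g (s : R) := f (y + s *: delta_mx 0 i).
have near_line (s : R) : `|s| <= `|h| ->
    derivable f (y + s *: delta_mx 0 i) (delta_mx 0 i) /\
    `|partial i f x - partial i f (y + s *: delta_mx 0 i)| <= e.
  move=> sh; apply: Hr; rewrite -ball_normE /ball_/= distrC addrAC.
  rewrite (le_lt_trans (ler_normD _ _))// normrZ.
  have s' : `|s| < r / (2 * D) by exact: le_lt_trans hr.
  move: s' yx; rewrite !ltr_pdivlMr ?mulr_gt0//.
  have : `|delta_mx 0 i : 'rV[R]_d| = D - 1 by rewrite /D addrK.
  move=> ->; have := normr_ge0 s; have := normr_ge0 (y - x).
  have : 1 <= D by rewrite /D lerDr.
  by move: (`|s|) (`|y - x|) => a b; nra.
have dg (s : R) : `|s| <= `|h| ->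
    is_derive s 1 g (partial i f (y + s *: delta_mx 0 i)).
  by move=> /near_line[df' _]; exact: is_derive_line.
have cg (a b : R) : `|a| <= `|h| -> `|b| <= `|h| ->
    {within `[a, b], continuous g}.
  move=> ah bh; apply: derivable_within_continuous => s.
  rewrite in_itv/= => /andP[as_ sb].
  have sh : `|s| <= `|h|.
    move: ah bh; rewrite !ler_norml => /andP[? _] /andP[_ ?].
    by apply/andP; split; [apply: le_trans as_|apply: le_trans sb _].
  by have [] := dg s sh.
have [c ch gc] : exists2 c : R, `|c| <= `|h| &
    g h - g 0 = partial i f (y + c *: delta_mx 0 i) * h.
  have n0 : `|0 : R| <= `|h| by rewrite normr0.
  have [h0|h0] := leP 0 h.
    have [c| |c] := @MVT_segment R g (fun s => partial i f (y + s *: delta_mx 0 i)) 0 h h0.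
    - rewrite in_itv/= => /andP[c0 ch]; apply: dg.
      by rewrite (ger0_norm h0) (gtr0_norm c0) ltW.
    - exact: cg.
    rewrite in_itv/= subr0 => /andP[c0 ch] ->; exists c => //.
    by rewrite !ger0_norm.
  have [c| |c] := @MVT_segment R g (fun s => partial i f (y + s *: delta_mx 0 i)) h 0 (ltW h0).
  - rewrite in_itv/= => /andP[hc c0]; apply: dg.
    by rewrite (ltr0_norm h0) (ltr0_norm c0) lerN2 ltW.
  - exact: cg.
  rewrite in_itv/= sub0r => /andP[hc c0] E; exists c.
    by rewrite (ler0_norm c0) (ltr0_norm h0) lerN2.
  by rewrite -opprB E mulrN opprK.
have -> : f (y + h *: delta_mx 0 i) - f y = g h - g 0.
  by rewrite /g scale0r addr0.
rewrite gc mulrC -mulrBr normrM mulrC ler_wpM2r// distrC.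
by have [] := near_line c ch.
Unshelve. all: by end_near. Qed.

Lemma C1_strict_derive (R : realType) (d : nat) (Omega : set 'rV[R]_d)
    (f : 'rV[R]_d -> R) (x w : 'rV[R]_d) :
  open Omega -> Ck 1 Omega f -> Omega x ->
  strict_derive f x w (\sum_i w 0 i * partial i f x).
Proof.
move=> oO [_ f1] Ox.
have Hi i : strict_derive f x (delta_mx 0 i) (partial i f x).
  have [df [cf _]] := f1 i.
  apply: strict_derive_partial; last by apply: cf; rewrite inE.
  have : \forall y \near x, Omega y by exact: open_nbhs_nbhs.
  by apply: filterS => y; exact: df.
rewrite {1}(row_sum_delta w).
apply: (big_rec2 (fun w L => strict_derive f x w L)); first exact: strict_derive0.
by move=> i w' L _ fw; apply: strict_deriveD => //; exact: strict_deriveZ.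
Qed.

Lemma strict_derive_is_derive (R : realType) (d : nat) (f : 'rV[R]_d -> R)
    (x w : 'rV[R]_d) (L : R) : strict_derive f x w L -> is_derive x w f L.
Proof.
move=> fw.
suff cv : (fun h : R => h^-1 *: ((f \o shift x) (h *: w) - f x)) @ 0^' --> L.
  by split; [apply/cvg_ex; exists L|exact: cvg_lim cv].
apply/cvgrPdist_le => e e0; have [r r0 Hr] := fw e e0.
near=> h.
have h0 : h != 0 by near: h; exact: nbhs_dnbhs_neq.
have hr : `|h| < r by near: h; exact: dnbhs0_lt.
have := Hr x h; rewrite subrr normr0 => /(_ r0 hr) H.
rewrite /= [h *: w + x]addrC distrC.
have -> : h^-1 *: (f (x + h *: w) - f x) - L =
    h^-1 * (f (x + h *: w) - f x - h * L).
  by rewrite mulrBr mulKf.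
by rewrite normrM normfV mulrC ler_pdivrMr ?normr_gt0.
Unshelve. all: by end_near. Qed.

Section local_max.
Context (R : realType) (d : nat) (Omega : set 'rV[R]_d) (f : 'rV[R]_d -> R).
Context (x : 'rV[R]_d).

Lemma partial_at_max (i : 'I_d) : open Omega -> Ck 1 Omega f -> Omega x ->
  (forall y, Omega y -> f y <= f x) -> partial i f x = 0.
Proof.
move=> oO f1 Ox fmax.
have le0 (w : 'rV[R]_d) : \sum_j w 0 j * partial j f x <= 0.
  apply/ler_addgt0Pr => e e0; rewrite add0r.
  have [r r0 Hr] := C1_strict_derive w oO f1 Ox e0.
  have /nbhs_ballP[r' /= r'0 Hr'] : \forall y \near x, Omega y.
    exact: open_nbhs_nbhs.
  pose h := Num.min (r / 2) (r' / (2 * (`|w| + 1))).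
  have w1 : 0 < `|w| + 1 by rewrite ltr_wpDl.
  have h0 : 0 < h by rewrite lt_min !divr_gt0// mulr_gt0.
  have hr : h < r by rewrite gt_min ltr_pdivrMr// ltr_pMr// ltr1n.
  have hw : h <= r' / (2 * (`|w| + 1)) by rewrite ge_min lexx orbT.
  have := Hr x h; rewrite subrr normr0 (gtr0_norm h0) => /(_ r0 hr).
  have : f (x + h *: w) <= f x.
    apply/fmax/Hr'; rewrite -ball_normE /ball_/= opprD addrA subrr sub0r normrN.
    rewrite normrZ (gtr0_norm h0); move: hw; rewrite ler_pdivlMr ?mulr_gt0//.
    have := normr_ge0 w; move: (`|w|) => a a0; nra.
  move: (f _) (f x) (\sum_j _) => a b c ab; rewrite ler_norml => /andP[].
  move=> H _; rewrite -(ler_pM2l h0); move: H; rewrite [h * e]mulrC; lra.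
have E (c : R) : \sum_j (c *: delta_mx 0 i : 'rV[R]_d) 0 j * partial j f x =
    c * partial i f x.
  rewrite (bigD1 i)//= big1 ?addr0.
    by rewrite !mxE !eqxx mulr1.
  by move=> j ji; rewrite !mxE/= (negbTE ji) mulr0 mul0r.
have := le0 (1 *: delta_mx 0 i); have := le0 (-1 *: delta_mx 0 i).
rewrite !E mul1r mulN1r oppr_le0 => ? ?.
by apply/eqP; rewrite eq_le; apply/andP.
Qed.

(** The gradient vanishes at x.  If the second derivative along w were positive,
    the first derivative along w would be positive shortly after x, and f would
    exceed its maximum there. *)
Lemma hessian_at_max (w : 'rV[R]_d) : open Omega -> Ck 2 Omega f -> Omega x ->
  (forall y, Omega y -> f y <= f x) ->
  \sum_i w 0 i * (\sum_j w 0 j * partial j (partial i f) x) <= 0.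
Proof.
move=> oO f2 Ox fmax.
have f1 : Ck 1 Omega f.
  have [cf df] := f2; split => // i; have [dfi [cfi _]] := df i.
  by split => //; split.
have C1 i : Ck 1 Omega (partial i f) by have [_ /(_ i)[]] := f2.
set Q := \sum_i _; rewrite leNgt; apply/negP => Q0.
pose W := \sum_i `|w 0 i|.
have W0 : 0 <= W by apply: sumr_ge0.
(* Small enough for the errors in the expansions of the partial derivatives,
   weighted by the coordinates of w, to stay below Q. *)
pose e := Q / (2 * (W + 1)).
have W1 : 0 < W + 1 by rewrite ltr_wpDl.
have e0 : 0 < e by rewrite divr_gt0// mulr_gt0.
have Hi i : exists2 r : R, 0 < r & forall h : R, `|h| < r ->
    `|partial i f (x + h *: w) - h * (\sum_j w 0 j * partial j (partial i f) x)|
      <= e * `|h|.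
  have [r r0 Hr] := C1_strict_derive w oO (C1 i) Ox e0.
  exists r => // h hr; have := Hr x h; rewrite subrr normr0 => /(_ r0 hr).
  by rewrite (partial_at_max i oO f1 Ox fmax) subr0.
have [r r0 Hr] : exists2 r : R, 0 < r & forall (h : R), `|h| < r -> forall i,
    `|partial i f (x + h *: w) - h * (\sum_j w 0 j * partial j (partial i f) x)|
      <= e * `|h|.
  have /choice[r Hr] : forall i, exists r : R, 0 < r /\ forall h : R, `|h| < r ->
    `|partial i f (x + h *: w) - h * (\sum_j w 0 j * partial j (partial i f) x)|
      <= e * `|h| by move=> i; have [r ? ?] := Hi i; exists r.
  exists (\big[Num.min/1]_i r i).
    by apply: lt_bigmin => // i _; have [] := Hr i.
  move=> h hr i; have [_] := Hr i; apply.
  by apply: lt_le_trans hr _; exact: bigmin_le_cond.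
have /nbhs_ballP[r' /= r'0 Hr'] : \forall y \near x, Omega y.
  exact: open_nbhs_nbhs.
pose s := Num.min (r / 2) (r' / (2 * (`|w| + 1))).
have w1 : 0 < `|w| + 1 by rewrite ltr_wpDl.
have s0 : 0 < s by rewrite lt_min !divr_gt0// mulr_gt0.
have sr : s < r by rewrite gt_min ltr_pdivrMr// ltr_pMr// ltr1n.
have sw : s <= r' / (2 * (`|w| + 1)) by rewrite ge_min lexx orbT.
have Oh (h : R) : 0 <= h <= s -> Omega (x + h *: w).
  move=> /andP[h0 hs]; apply: Hr'.
  rewrite -ball_normE /ball_/= opprD addrA subrr sub0r normrN.
  rewrite normrZ (ger0_norm h0).
  have := le_trans hs sw; rewrite ler_pdivlMr ?mulr_gt0//.
  have := normr_ge0 w; move: (`|w|) => a a0; nra.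
pose g (h : R) := f (x + h *: w).
pose g' (h : R) := \sum_i w 0 i * partial i f (x + h *: w).
have dg (h : R) : 0 <= h <= s -> is_derive h 1 g (g' h).
  move=> /Oh Oxh.
  have [df dE] := strict_derive_is_derive (C1_strict_derive w oO f1 Oxh).
  by rewrite /g' -dE; exact: is_derive_line.
have [c| |c] := @MVT R g g' 0 s s0.
- by rewrite in_itv/= => /andP[c0 cs]; apply: dg; rewrite !ltW.
- apply: derivable_within_continuous => h; rewrite in_itv/= => /dg; by case.
rewrite in_itv/= subr0 => /andP[c0 cs] gs.
have : g s <= g 0 by rewrite /g scale0r addr0; apply/fmax/Oh; rewrite lexx ltW.
rewrite -subr_le0 gs pmulr_lle0// leNgt => /negP; apply.
have cr : `|c| < r by rewrite gtr0_norm// (lt_trans cs).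
have Hg : c * Q - g' c <= e * c * W.
  rewrite /Q /g' /W !mulr_sumr -sumrB; apply: ler_sum => i _.
  rewrite [c * _]mulrCA -mulrBr (le_trans (ler_norm _))// normrM mulrC.
  by rewrite ler_wpM2r// distrC -[in leRHS](gtr0_norm c0) Hr.
have : e * W < Q.
  rewrite /e mulrAC ltr_pdivrMr ?mulr_gt0// ltr_pM2l//; lra.
rewrite -(ltr_pM2l c0) mulrCA mulrA => H2.
move: Hg H2; move: (e * c * W) (c * Q) (g' c) => p q z; lra.
Qed.

End local_max.

(** With A = W W^T the trace is the sum of the quadratic forms of H at the
    columns of W. *)
Lemma trace_mul_posdef_le0 (R : realType) (d : nat) (A H : 'M[R]_d) :
  A^T = A -> posdef A ->
  (forall w : 'rV[R]_d, \sum_i w 0 i * (\sum_j w 0 j * H i j) <= 0) ->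
  \sum_i \sum_j A i j * H i j <= 0.
Proof.
move=> symA posA Hw; have [W ->] := posdef_factor symA posA.
have -> : \sum_i \sum_j (W *m W^T) i j * H i j =
    \sum_k \sum_i (row k W^T) 0 i * (\sum_j (row k W^T) 0 j * H i j).
  rewrite [RHS]exchange_big; apply: eq_bigr => i _.
  under [RHS]eq_bigr do rewrite mulr_sumr.
  rewrite [RHS]exchange_big; apply: eq_bigr => j _.
  rewrite !mxE mulr_suml; apply: eq_bigr => k _.
  by rewrite !mxE mulrA.
by apply: sumr_le0 => k _; exact: Hw.
Qed.

(** As the gradient vanishes, neither the derivatives of the coefficients nor
    the first order terms contribute. *)
Lemma ellipticL_at_max (R : realType) (d : nat) (Omega : set 'rV[R]_d)
    (a : 'rV[R]_d -> R -> 'M[R]_d) (b : 'rV[R]_d -> R -> 'rV[R]_d)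
    (t : R) (v : 'rV[R]_d -> R) (x : 'rV[R]_d) :
  open Omega -> Omega x ->
  (forall i j, a x t i j = a x t j i) -> posdef (a x t) ->
  (forall i j, Ck 1 Omega (fun y => a y t i j)) -> Ck 2 Omega v ->
  (forall y, Omega y -> v y <= v x) ->
  0 <= ellipticL a b t v x.
Proof.
move=> oO Ox syma posa a1 v2 vmax.
have v1 : Ck 1 Omega v.
  have [cf df] := v2; split => // i; have [dfi [cfi _]] := df i.
  by split => //; split.
have p0 i : partial i v x = 0 by exact: (partial_at_max i oO v1 Ox vmax).
rewrite /ellipticL [X in _ + X]big1 ?addr0; last by move=> i _; rewrite p0 mulr0.
have E i j : partial i (fun y => a y t i j * partial j v y) x =
    a x t i j * partial i (partial j v) x.
  rewrite /partial deriveM.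
  - by rewrite -/(partial j v x) p0 scale0r addr0.
  - by have [_ /(_ i)[+ _]] := a1 i j; apply.
  - by have [_ /(_ j)[_ [_ /(_ i)[+ _]]]] := v2; apply.
rewrite oppr_ge0; under eq_bigr do under eq_bigr do rewrite E.
have symA : (a x t)^T = a x t by apply/matrixP => i j; rewrite mxE.
have := trace_mul_posdef_le0 (H := \matrix_(i, j) partial j (partial i v) x)
  symA posa.
move=> H; apply: le_trans (H _); last first.
  move=> w; apply: le_trans (hessian_at_max w oO v2 Ox vmax).
  rewrite le_eqVlt; apply/orP; left; apply/eqP.
  by apply: eq_bigr => i _; congr (_ * _); apply: eq_bigr => j _; rewrite mxE.
rewrite le_eqVlt; apply/orP; left; apply/eqP.
rewrite exchange_big; apply: eq_bigr => i _; apply: eq_bigr => j _.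
by rewrite mxE syma.
Qed.

(** * The maximum principle *)

Lemma compact_closure_bounded (R : realType) (d : nat) (A : set 'rV[R]_d) :
  bounded_set A -> compact (closure A).
Proof.
move=> bA; apply: bounded_closed_compact; last exact: closed_closure.
have [M [Mr HM]] := bA; exists M; split => // N MN.
have AN : A `<=` [set x | `|x| <= N] by move=> x; exact: HM.
suff : closure A `<=` [set x | `|x| <= N] by [].
rewrite closureE; apply: smallest_sub AN.
have -> : [set x : 'rV[R]_d | `|x| <= N] =
    (fun x => `|x|) @^-1` [set y : R | y <= N] by [].
apply: closed_comp; last exact: closed_le.
by move=> x _; exact: norm_continuous.
Qed.

Lemma closure_open_boundary (T : topologicalType) (A : set T) (x : T) :
  open A -> closure A x -> ~ boundary A x -> A x.
Proof.
move=> oA cx nb; apply: contrapT => nA; apply: nb; split => //.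
by move=> /interior_subset.
Qed.

Lemma continuous_slice (R : realType) (X : topologicalType) (K : set X)
    (T t : R) (x : X) (u : X -> R -> R) :
  {within K `*` `[0, T], continuous (fun z : X * R => u z.1 z.2)} ->
  K x -> t <= T -> {within `[0, t], continuous (u x)}.
Proof.
move=> cu Kx tT; apply/subspace_continuousP => s st.
have /subspace_continuousP/(_ (x, s)) := cu.
have sT : `[0, T]%classic s.
  by move: st; rewrite /= !in_itv/= => /andP[-> /le_trans]; exact.
move=> /(_ (conj Kx sT)) cus.
have key : (fun r : R => (x, r)) @ within `[0, t]%classic (nbhs s) -->
    within (K `*` `[0, T]%classic) (nbhs (x, s)).
  move=> W [[P Q] [/= Px Qs] PQW].
  apply: filterS Qs => r Qr rt; apply: PQW.
    by split => //=; exact: nbhs_singleton.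
  split => //=.
  by move: rt; rewrite /= !in_itv/= => /andP[-> /le_trans]; exact.
exact: (cvg_comp _ _ key cus).
Qed.

(** A positive maximum M at a time tm in ]t0, t0 + tau] would make the Caputo
    derivative at least M / 2 times tau ^ (- alpha) / Gamma (1 - alpha), which
    beats the lower bound - lambda M for the zero order term.  The bound on
    tau does not involve t0, M or the solution. *)
Lemma fractional_max_principle_step (R : realType) (d : nat) (alpha T lambda : R)
    (Omega : set 'rV[R]_d)
    (a : 'rV[R]_d -> R -> 'M[R]_d) (b : 'rV[R]_d -> R -> 'rV[R]_d)
    (c : 'rV[R]_d -> R -> R) (u : 'rV[R]_d -> R -> R) (t0 tau : R) :
  0 < alpha < 1 -> open Omega -> bounded_set Omega ->
  (forall (x : 'rV[R]_d) (t : R), Omega x -> 0 < t <= T ->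
     (forall i j, a x t i j = a x t j i) /\ posdef (a x t)) ->
  (forall t : R, 0 < t <= T ->
     forall i j, Ck 1 Omega (fun x : 'rV[R]_d => a x t i j)) ->
  (forall (x : 'rV[R]_d) (t : R), Omega x -> 0 < t <= T -> - lambda <= c x t) ->
  (forall (x : 'rV[R]_d) (t : R), boundary Omega x -> 0 <= t <= T -> u x t <= 0) ->
  {within closure Omega `*` `[0, T], continuous (fun z : 'rV[R]_d * R => u z.1 z.2)} ->
  (forall t : R, 0 < t <= T -> Ck 2 Omega (fun x : 'rV[R]_d => u x t)) ->
  (forall (x : 'rV[R]_d) (eps t : R), Omega x -> 0 < eps -> eps < t -> t <= T ->
     W1infty eps t (u x)) ->
  (forall (x : 'rV[R]_d) (t : R), Omega x -> 0 < t <= T ->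
     caputo alpha (u x) t + ellipticL a b t (fun y => u y t) x
       + c x t * u x t <= 0) ->
  0 <= t0 -> 0 < tau ->
  2 * lambda * Gamma (1 - alpha) < tau `^ (- alpha) ->
  (forall (x : 'rV[R]_d) (t : R), closure Omega x -> 0 <= t <= T -> t <= t0 ->
     u x t <= 0) ->
  forall (x : 'rV[R]_d) (t : R), closure Omega x -> 0 <= t <= T ->
    t <= t0 + tau -> u x t <= 0.
Proof.
move=> alpha01 oO bO posa a1 cl ubnd cu u2 uW eqn t00 tau0 tauG IH x t Kx tT ttau.
rewrite leNgt; apply/negP => uxt.
pose T' := Num.min T (t0 + tau).
have T'T : T' <= T by rewrite ge_min lexx.
have T'tau : T' <= t0 + tau by rewrite ge_min lexx orbT.
have [/andP[t_ge0 t_leT]] := (tT, tT); move=> _.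
have tT' : t <= T' by rewrite le_min t_leT.
have cK : compact (closure Omega `*` `[0, T']).
  by apply: compact_setX; [exact: compact_closure_bounded|exact: segment_compact].
have cu' : {within closure Omega `*` `[0, T'],
    continuous (fun z : 'rV[R]_d * R => u z.1 z.2)}.
  apply: continuous_subspaceW cu => -[y s] [/= Ky].
  by rewrite !in_itv/= => /andP[-> /le_trans sT]; split => //; exact: sT.
have K0 : (closure Omega `*` `[0, T']) !=set0.
  by exists (x, t); split => //=; rewrite in_itv/= t_ge0.
have [[xm tm] /=] := compact_EVT_max K0 cK cu'.
rewrite inE => -[/= Kxm]; rewrite in_itv/= => /andP[tm0 tmT'] umax.
set M := u xm tm in umax.
have {}umax y s : closure Omega y -> 0 <= s <= T' -> u y s <= M.
  by move=> Ky sT; apply: (umax (y, s)); rewrite inE; split.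
have M0 : 0 < M by apply: lt_le_trans uxt _; apply: umax; rewrite ?t_ge0.
have tmT : tm <= T by exact: le_trans T'T.
have t0m : t0 < tm.
  by rewrite ltNge; apply: contraTN M0 => tmt0; rewrite -leNgt /M IH// tm0.
have tmgt0 : 0 < tm by exact: le_lt_trans t0m.
have tm_in : 0 < tm <= T by rewrite tmgt0.
have Oxm : Omega xm.
  apply: closure_open_boundary => // bxm.
  by move: M0; rewrite ltNge => /negP; apply; apply: ubnd; rewrite ?tm0.
have cf : {within `[0, tm], continuous (u xm)} by exact: continuous_slice cu Kxm tmT.
(* The solution is nonpositive up to t0, hence at most M / 2 a little longer;
   this leaves room for a mass between t0 and y. *)
have [y [t0y ytm fy]] : exists y, [/\ t0 < y, y < tm &
    forall r, 0 <= r <= y -> u xm r <= M - M / 2].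
  have /subspace_continuousP/(_ t0) := cf.
  rewrite /= in_itv/= t00 (ltW t0m) => /(_ isT)/cvgrPdist_le/(_ (M / 2)).
  rewrite divr_gt0// => /(_ isT); rewrite /within/= => -[r /= r0 Hr].
  exists (Num.min (t0 + r / 2) ((t0 + tm) / 2)); split.
  - by rewrite lt_min; apply/andP; split; lra.
  - by rewrite gt_min; apply/orP; right; lra.
  move=> s /andP[s0]; rewrite le_min => /andP[sr stm].
  have f0 : u xm t0 <= 0 by apply: IH => //; rewrite t00 (le_trans (ltW t0m)).
  have [st0|t0s] := leP s t0.
    apply: (@le_trans _ _ 0); last by lra.
    by apply: IH; rewrite ?s0//=; lra.
  have := Hr s; rewrite /ball/= ltr_norml in_itv/= s0/= => H.
  have : `|u xm t0 - u xm s| <= M / 2 by apply: H; [apply/andP; split; lra|lra].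
  by rewrite ler_norml => /andP[? ?]; lra.
pose z := (t0 + y) / 2.
have z0 : 0 < z by rewrite /z; lra.
have zy : z < y by rewrite /z; lra.
have t0z : t0 < z by rewrite /z; lra.
have G0 : 0 < Gamma (1 - alpha) by case/andP : alpha01 => *; apply: Gamma_gt0; lra.
have Dge : (Gamma (1 - alpha))^-1 * (M / 2 * (tm - z) `^ (- alpha)) <=
    caputo alpha (u xm) tm.
  apply: (@caputo_max_ge _ _ _ _ (M / 2) z y) => //.
  - by move=> e /andP[e0 et]; exact: uW.
  - by rewrite divr_ge0// ltW.
  - move=> r /andP[r0 rt]; apply: umax; first exact: Kxm.
    by rewrite r0 (le_trans (ltW rt)).
have kz : tau `^ (- alpha) <= (tm - z) `^ (- alpha).
  have := @kernel_nondecreasing _ alpha tm (tm - tau) z.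
  by rewrite opprB addrCA subrr addr0; apply; case/andP : alpha01 => // *; lra.
have Lge : 0 <= ellipticL a b tm (fun y => u y tm) xm.
  have [syma posaxm] := posa xm tm Oxm tm_in.
  apply: (ellipticL_at_max (Omega := Omega)) => //.
  - exact: a1.
  - exact: u2.
  - by move=> w Ow; apply: umax; [exact: subset_closure|rewrite tm0].
have cge : - lambda * M <= c xm tm * u xm tm by rewrite ler_pM2r// cl.
have := eqn xm tm Oxm tm_in.
apply/negP; rewrite -ltNge.
have lM : lambda * M < (Gamma (1 - alpha))^-1 * (M / 2 * (tm - z) `^ (- alpha)).
  rewrite [ltRHS]mulrC ltr_pdivlMr//.
  have := lt_le_trans tauG kz.
  rewrite -(ltr_pM2l M0); move: (Gamma _) (_ `^ _) (M) => G k m.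
  by rewrite [m * (_ * G)]mulrCA; nra.
move: lM Dge Lge cge; rewrite mulNr.
move: (caputo _ _ _) (ellipticL _ _ _ _ _) (c _ _ * _) (_^-1 * _) (lambda * M).
by move=> *; lra.
Qed.

Theorem theorem2p3 (R : realType) (d : nat) (alpha T lambda : R)
    (Omega : set 'rV[R]_d)
    (a : 'rV[R]_d -> R -> 'M[R]_d) (b : 'rV[R]_d -> R -> 'rV[R]_d)
    (c : 'rV[R]_d -> R -> R) (u : 'rV[R]_d -> R -> R) :
  0 < alpha < 1 ->
  0 < T ->
  (1 <= d <= 3)%N ->
  bounded_lipschitz_domain Omega ->
  (forall (x : 'rV[R]_d) (t : R), Omega x -> 0 < t <= T ->
     (forall i j, a x t i j = a x t j i) /\ posdef (a x t)) ->
  (forall t : R, 0 < t <= T ->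
     [/\ forall i j, Ck 1 Omega (fun x : 'rV[R]_d => a x t i j),
         forall i, Ck 0 Omega (fun x : 'rV[R]_d => b x t 0 i) &
         Ck 0 Omega (fun x : 'rV[R]_d => c x t)]) ->
  0 <= lambda ->
  (forall (x : 'rV[R]_d) (t : R), Omega x -> 0 < t <= T -> - lambda <= c x t) ->
  (forall x : 'rV[R]_d, Omega x -> u x 0 <= 0) ->
  (forall (x : 'rV[R]_d) (t : R), boundary Omega x -> 0 <= t <= T -> u x t <= 0) ->
  {within closure Omega `*` `[0, T], continuous (fun z : 'rV[R]_d * R => u z.1 z.2)} ->
  (forall t : R, 0 < t <= T -> Ck 2 Omega (fun x : 'rV[R]_d => u x t)) ->
  (forall (x : 'rV[R]_d) (eps t : R), Omega x -> 0 < eps -> eps < t -> t <= T ->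
     W1infty eps t (u x)) ->
  (forall (x : 'rV[R]_d) (t : R), Omega x -> 0 < t <= T ->
     caputo alpha (u x) t + ellipticL a b t (fun y => u y t) x
       + c x t * u x t <= 0) ->
  forall (x : 'rV[R]_d) (t : R), closure Omega x -> 0 <= t <= T -> u x t <= 0.
Proof.
move=> alpha01 T0 _ [_ oO _ bO _] posa abc lambda0 cl u0 ubnd cu u2 uW eqn.
have G0 : 0 < Gamma (1 - alpha) by case/andP : alpha01 => *; apply: Gamma_gt0; lra.
pose B := 2 * lambda * Gamma (1 - alpha) + 1.
have B0 : 0 < B by rewrite ltr_wpDl// !mulr_ge0// ltW.
pose tau := B `^ (- alpha^-1).
have tau0 : 0 < tau by exact: powR_gt0.
have tauE : tau `^ (- alpha) = B.
  rewrite /tau -powRrM mulrNN mulVf ?powRr1 ?(ltW B0)//.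
  by case/andP : alpha01 => *; rewrite gt_eqF.
have steps n (x : 'rV[R]_d) (t : R) : closure Omega x -> 0 <= t <= T ->
    t <= n%:R * tau -> u x t <= 0.
  elim: n x t => [|n IH] x t Kx tT.
    rewrite mul0r => t_le0; have -> : t = 0.
      by apply/eqP; rewrite eq_le t_le0; case/andP : tT.
    have [bx|nbx] := pselect (boundary Omega x).
      by apply: ubnd; rewrite ?lexx ?ltW.
    by apply: u0; exact: closure_open_boundary.
  rewrite -natr1 mulrDl mul1r.
  apply: (@fractional_max_principle_step _ _ alpha T lambda Omega a b c u
    (n%:R * tau) tau) => //.
  - by move=> s sT; have [] := abc s sT.
  - by rewrite mulr_ge0// ltW.
  - by rewrite tauE /B ltrDl.
move=> x t Kx tT.
near \oo => n.
apply: (steps n) => //.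
rewrite -ler_pdivrMr//.
by near: n; exact: nbhs_infty_ger.
Unshelve. all: by end_near. Qed.
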